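(* Let $\mathcal{E}=\{\rho_i\}_{i=1}^a$ be a finite set of quantum states on a finite-dimensional Hilbert space $B$, with supports $K_i=\mathrm{supp}\,\rho_i$ and support projectors $P_i$, and let $K=\mathrm{span}\{|\psi\rangle\langle i|:|\psi\rangle\in K_i,\ i=1,\dots,a\}\subseteq\mathcal{L}(\mathbb{C}^a\to B)$. Then the following are equivalent: (i) $\overline{C}_{0EF}(K)>0$; (ii) $K$ is nontrivial; (iii) $\bigcap_iK_i=\{0\}$; (iv) $\left\|\sum_iP_i\right\|_\infty<a$; (v) $\mathrm{A}(K)>1$; (vi) for some $n$ and some type $\tau$ of strings in $[a]^n$, the set $\mathcal{E}^{(n)}_\tau$ can be conclusively excluded.
   Context: $\{|i\rangle\}$ is the standard basis of $\mathbb{C}^a$. $K$ is trivial if there is a unit vector $|\beta\rangle\in B$ with $|\beta\rangle\langle x|\in K$ for all $|x\rangle\in\mathbb{C}^a$. $\mathrm{A}(K)=\max\{\sum_is_i: s_i\ge0,\ \sum_is_iP_i\le\mathbb{1}\}$. For $\underline{i}=i_1\dots i_n\in[a]^n$ its type is the empirical distribution of its letters; $\mathcal{E}^{(n)}_\tau=\{\rho_{\underline i}=\rho_{i_1}\otimes\cdots\otimes\rho_{i_n}:\underline i\text{ has type }\tau\}$. A set $\{\rho_s\}_s$ is conclusively excluded if there is a POVM $(M_s)_s$ indexed by the same labels with $\mathrm{tr}\,\rho_sM_s=0$ for all $s$. Activated feedback-assisted zero-error capacity of $K$ (which is the Choi–Kraus space of the cq-channel $\rho\mapsto\sum_i\langle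 i|\rho|i\rangle\rho_i$): a feedback-assisted code with $n$ channel uses and $b$ noiseless bits consists of a pure state $|\phi\rangle\in X_0\otimes Y_0$ and $n+b$ rounds; in round $t$ Alice applies an isometry $U^{(m)}_t:X_{t-1}\otimes F_{t-1}\to A_t\otimes X_t$ depending on message $m$, $A_t$ is sent through the channel (in $n$ rounds) or through the noiseless bit channel $\rho\mapsto\sum_{j=0,1}|j\rangle\langle j|\rho|j\rangle\langle j|$ (in $b$ rounds), and Bob applies an isometry $W_t:Y_{t-1}\otimes B_t\to F_t\otimes Y_t$ returning $F_t$ to Alice; it is zero-error if Bob's final states for distinct messages are orthogonally supported (this depends only on $K$). $M_f^{+b}(n;K)$ is the maximal number of messages and $\overline{C}_{0EF}(K)=\sup_b\lim_n\frac1n\log M_f^{+b}(n;K)$. *)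

(* Defs.v *)
From HB Require Import structures.
From mathcomp Require Import all_boot all_order all_algebra complex.
From mathcomp Require Import boolp classical_sets reals ereal sequences exp.

Set Implicit Arguments.
Unset Strict Implicit.
Unset Printing Implicit Defensive.

Import Order.TTheory GRing.Theory Num.Theory.
Local Open Scope ring_scope.
Local Open Scope classical_set_scope.

Section QDefs.
Variable R : realType.
Local Notation C := R[i].

Definition adjmx m n (A : 'M[C]_(m, n)) : 'M[C]_(n, m) := (map_mx conjc A)^T.
Definition cdot n (v w : 'cV[C]_n) : C := (adjmx v *m w) 0 0.
Definition vnorm n (v : 'cV[C]_n) : R := Num.sqrt (complex.Re (cdot v v)).
Definition psdmx n (A : 'M[C]_n) : Prop := forall v : 'cV[C]_n, 0 <= cdot v (A *m v).
Definition lemx n (A B : 'M[C]_n) : Prop := psdmx (B - A).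
Definition is_state n (rho : 'M[C]_n) : Prop := psdmx rho /\ \tr rho = 1.
(* range (= support, for a psd matrix) *)
Definition mxrange m n (A : 'M[C]_(m, n)) : set 'cV[C]_m :=
  [set v | exists w : 'cV[C]_n, v = A *m w].
Definition is_supp_proj n (P rho : 'M[C]_n) : Prop :=
  P *m P = P /\ adjmx P = P /\ mxrange P = mxrange rho.
Definition opnorm m n (A : 'M[C]_(m, n)) : R :=
  sup [set vnorm (A *m v) | v in [set v : 'cV[C]_n | vnorm v = 1]].

Definition bra a (i : 'I_a) : 'rV[C]_a := delta_mx 0 i.

Definition inK a d (rho : 'I_a -> 'M[C]_d) (M : 'M[C]_(d, a)) : Prop :=
  exists (k : nat) (c : 'I_k -> C) (idx : 'I_k -> 'I_a) (psi : 'I_k -> 'cV[C]_d),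
    (forall j, mxrange (rho (idx j)) (psi j)) /\
    M = \sum_(j < k) c j *: (psi j *m bra (idx j)).

Definition trivialK a d (rho : 'I_a -> 'M[C]_d) : Prop :=
  exists beta : 'cV[C]_d, vnorm beta = 1 /\
    forall x : 'cV[C]_a, inK rho (beta *m adjmx x).

Definition AK a d (P : 'I_a -> 'M[C]_d) : R :=
  sup [set \sum_(i < a) s i | s in
        [set s : 'I_a -> R | (forall i, 0 <= s i) /\
           lemx (\sum_(i < a) real_complex R (s i) *: P i) 1%:M]].

(* op I J = linear maps C^J -> C^I, given by their matrix entries *)
Definition op (I J : finType) := I -> J -> C.
Definition opmul (I J K : finType) (A : op I J) (B : op J K) : op I K :=
  fun i k => \sum_(j : J) A i j * B j k.
Definition opadj (I J : finType) (A : op I J) : op J I := fun j i => conjc (A i j).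
Definition opid (I : finType) : op I I := fun i j => (i == j)%:R.
Definition optr (I : finType) (A : op I I) : C := \sum_(i : I) A i i.
Definition oppsd (I : finType) (A : op I I) : Prop :=
  forall v : I -> C, 0 <= \sum_(i : I) \sum_(j : I) conjc (v i) * A i j * v j.
Definition oprange (I J : finType) (A : op I J) : set (I -> C) :=
  [set v | exists w : J -> C, v = fun i => \sum_(j : J) A i j * w j].
Definition is_isometry (I J : finType) (U : op I J) : Prop :=
  opmul (opadj U) U = @opid J.

(* rho_{i_1} (x) ... (x) rho_{i_n} on (C^d)^{(x) n} = C^([d]^n) *)
Definition prodstate a d (rho : 'I_a -> 'M[C]_d) n (s : n.-tuple 'I_a) :
    op (n.-tuple 'I_d) (n.-tuple 'I_d) :=
  fun u v => \prod_(k < n) rho (tnth s k) (tnth u k) (tnth v k).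

Definition same_type a n (s t : n.-tuple 'I_a) : bool :=
  [forall k : 'I_a, count_mem k s == count_mem k t].

(* E^(n)_tau, with tau the type of the string t, is conclusively excluded:
   there is a POVM (M_s)_s indexed by the strings s of type tau with
   tr rho_s M_s = 0 for all s. *)
Definition type_excludable a d (rho : 'I_a -> 'M[C]_d) n (t : n.-tuple 'I_a) : Prop :=
  exists M : n.-tuple 'I_a -> op (n.-tuple 'I_d) (n.-tuple 'I_d),
    (forall s, same_type s t -> oppsd (M s)) /\
    (forall u v, \sum_(s | same_type s t) M s u v = @opid _ u v) /\
    (forall s, same_type s t -> optr (opmul (prodstate rho s) (M s)) = 0).

(* a classical-quantum channel  sigma |-> sum_i <i|sigma|i> st_i *)
Record cqchan := CQChan {
  cq_in : finType; cq_out : finType; cq_st : cq_in -> op cq_out cq_out }.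

Definition chanK a d (rho : 'I_a -> 'M[C]_d) : cqchan :=
  @CQChan 'I_a 'I_d (fun i o o' => rho i o o').
Definition bitchan : cqchan :=
  @CQChan 'I_2 'I_2 (fun j o o' => ((o == j) && (o' == j))%:R).
Definition round_chan a d (rho : 'I_a -> 'M[C]_d) (use : bool) : cqchan :=
  if use then chanK rho else bitchan.

(* Alice applies an isometry U : X_{t-1} (x) F_{t-1} -> A_t (x) X_t
   (joint state on (X_{t-1} (x) F_{t-1}) (x) Y_{t-1}) *)
Definition alice_step (Xo Fo Y A Xn : finType) (U : op (A * Xn)%type (Xo * Fo)%type)
    (r : op ((Xo * Fo) * Y)%type ((Xo * Fo) * Y)%type) : op ((A * Xn) * Y)%type ((A * Xn) * Y)%type :=
  fun p q => \sum_(xf : (Xo * Fo)%type) \sum_(xf' : (Xo * Fo)%type)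
     U p.1 xf * r (xf, p.2) (xf', q.2) * conjc (U q.1 xf').

Definition channel_step (ch : cqchan) (Xn Y : finType)
    (s : op ((cq_in ch * Xn) * Y)%type ((cq_in ch * Xn) * Y)%type) :
    op ((cq_out ch * Xn) * Y)%type ((cq_out ch * Xn) * Y)%type :=
  fun p q => \sum_(i : cq_in ch)
     cq_st i p.1.1 q.1.1 * s ((i, p.1.2), p.2) ((i, q.1.2), q.2).

(* Bob applies an isometry W : Y_{t-1} (x) B_t -> F_t (x) Y_t *)
Definition bob_step (Bo Xn Y Fn Yn : finType) (W : op (Fn * Yn)%type (Y * Bo)%type)
    (s : op ((Bo * Xn) * Y)%type ((Bo * Xn) * Y)%type) :
    op ((Xn * Fn) * Yn)%type ((Xn * Fn) * Yn)%type :=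
  fun p q => \sum_(y : Y) \sum_(o : Bo) \sum_(y' : Y) \sum_(o' : Bo)
     W (p.1.2, p.2) (y, o) * s ((o, p.1.1), y) ((o', q.1.1), y')
       * conjc (W (q.1.2, q.2) (y', o')).

(* A feedback-assisted code with n channel uses, b noiseless bits and M
   messages.  Rounds are numbered t = 0, ..., n+b-1; round t maps
   X_t, F_t, Y_t to X_{t+1}, F_{t+1}, Y_{t+1}.  The systems are
   X_t = C^(xd t), F_t = C^(fd t), Y_t = C^(yd t); F_0 is trivial. *)
Local Unset Implicit Arguments.
Record fcode a d (rho : 'I_a -> 'M[C]_d) (n b M : nat) := FCode {
  sched : nat -> bool;
  sched_count : count sched (iota 0 (n + b)%N) = n;
  xd : nat -> nat; fd : nat -> nat; yd : nat -> nat;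
  fd0 : fd 0 = 1%N;
  phi : (('I_(xd 0) * 'I_(fd 0)) * 'I_(yd 0))%type -> C;
  phi_unit : \sum_(z : (('I_(xd 0) * 'I_(fd 0)) * 'I_(yd 0))%type) conjc (phi z) * phi z = 1;
  encU : forall (m : 'I_M) (t : nat),
      op (cq_in (round_chan rho (sched t)) * 'I_(xd t.+1))%type ('I_(xd t) * 'I_(fd t))%type;
  encU_iso : forall m t, (t < n + b)%N -> is_isometry (encU m t);
  decW : forall t : nat,
      op ('I_(fd t.+1) * 'I_(yd t.+1))%type ('I_(yd t) * cq_out (round_chan rho (sched t)))%type;
  decW_iso : forall t, (t < n + b)%N -> is_isometry (decW t)
}.
Local Set Implicit Arguments.
Arguments fcode {a d} rho n b M.
Arguments sched {a d rho n b M}. Arguments xd {a d rho n b M}.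
Arguments fd {a d rho n b M}. Arguments yd {a d rho n b M}.
Arguments phi {a d rho n b M}. Arguments encU {a d rho n b M}.
Arguments decW {a d rho n b M}.

Fixpoint code_state a d (rho : 'I_a -> 'M[C]_d) n b M (c : fcode rho n b M)
    (m : 'I_M) (t : nat) :
    op (('I_(xd c t) * 'I_(fd c t)) * 'I_(yd c t))%type
       (('I_(xd c t) * 'I_(fd c t)) * 'I_(yd c t))%type :=
  match t with
  | 0 => fun p q => phi c p * conjc (phi c q)
  | t'.+1 => bob_step (decW c t')
               (channel_step (alice_step (encU c m t') (@code_state a d rho n b M c m t')))
  end.
Arguments code_state {a d rho n b M} c m t.

Definition bob_final a d (rho : 'I_a -> 'M[C]_d) n b M (c : fcode rho n b M)
    (m : 'I_M) : op 'I_(yd c (n + b)%N) 'I_(yd c (n + b)%N) :=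
  fun y y' => \sum_(xf : ('I_(xd c (n + b)%N) * 'I_(fd c (n + b)%N))%type)
                 code_state c m (n + b)%N (xf, y) (xf, y').
Arguments bob_final {a d rho n b M} c m.

Definition zero_error a d (rho : 'I_a -> 'M[C]_d) n b M (c : fcode rho n b M) : Prop :=
  forall m m' : 'I_M, m != m' ->
    forall v w, oprange (bob_final c m) v -> oprange (bob_final c m') w ->
      \sum_(y : 'I_(yd c (n + b)%N)) conjc (v y) * w y = 0.

Local Open Scope ereal_scope.

Definition Mf a d (rho : 'I_a -> 'M[C]_d) (b n : nat) : \bar R :=
  ereal_sup [set (M%:R)%:E | M in [set M : nat |
                 exists c : fcode rho n b M, zero_error c]].

Definition rate a d (rho : 'I_a -> 'M[C]_d) (b n : nat) : \bar R :=
  match Mf rho b n with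
  | x%:E => ((ln x / ln 2) / n%:R)%:E
  | +oo => +oo
  | -oo => -oo
  end.

(* activated feedback-assisted zero-error capacity
   sup_b lim_n (1/n) log M_f^{+b}(n;K); the limit is taken as lim inf *)
Definition C0EF_act a d (rho : 'I_a -> 'M[C]_d) : \bar R :=
  ereal_sup [set limn_einf (rate rho b) | b in [set: nat]].

End QDefs.

(* Main.v *)
(** The conditions on the supports are all equivalent to the vanishing of the
    intersection of the K_i by elementary spectral theory; the substance lies in the
    two operational conditions.

    Exclusion.  If the K_i intersect trivially, then sum_i P_i <= c with c < a, so the
    sum of the P_s over all strings s is at most c^n.  The largest type class has at
    least a^n/(n+1)^a elements, so for large n the average of P_s over it has norm at
    most 1/12.  With Q_s = 1 - P_s, the map X |-> avg_s Q_s X Q_s is then so close to the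
    identity that it is invertible and the preimage X of 1 is positive; the operators
    Q_s X Q_s / N form the excluding POVM.

    Codes.  Excluding measurements on consecutive blocks turn the channel into one that
    rules out one of N letters per block.  There are exponentially long lists of
    codewords over these letters in which any N codewords are separated at some block,
    i.e. exhibit all N letters there; hence the outcomes leave fewer than N candidates.
    Bob feeds this list back and Alice resolves it with constantly many noiseless bits.

    Converse.  If a unit vector beta lies in all K_i, every output state dominates a
    multiple of |beta><beta|, and the noiseless bit is at most twice the completely
    depolarising one.  So every final state of Bob has a part, of trace one and with
    support in its range, which is at most 2^b times a state that does not depend on
    the message; orthogonality leaves room for 2^b messages only. *)
Require Import Defs.
From HB Require Import structures.
From mathcomp Require Import all_boot all_order all_algebra complex.
From mathcomp Require Import boolp classical_sets reals ereal sequences exp.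
From mathcomp Require Import spectral ring lra zify.

Set Implicit Arguments.
Unset Strict Implicit.
Unset Printing Implicit Defensive.

Import Order.TTheory GRing.Theory Num.Theory.
Local Open Scope ring_scope.

(** * Operators on finite index sets *)

Section Operators.
Variable R : realType.
Local Notation C := R[i].
Implicit Types I J K L : finType.

Lemma sum_delta I (i : I) (F : I -> C) : \sum_j (i == j)%:R * F j = F i.
Proof.
rewrite (bigD1 i) //= eqxx mul1r big1 ?addr0 // => j ji.
by rewrite eq_sym (negbTE ji) mul0r.
Qed.

Lemma conjcD (x y : C) : conjc (x + y) = conjc x + conjc y.
Proof. exact: rmorphD. Qed.

Lemma conjcM (x y : C) : conjc (x * y) = conjc x * conjc y.
Proof. exact: rmorphM. Qed.

Lemma conjM_ge0 (x : C) : 0 <= conjc x * x.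
Proof. by rewrite mulrC mulcJ_ge0. Qed.

Lemma conjc_sum I (P : pred I) (F : I -> C) :
  conjc (\sum_(i | P i) F i) = \sum_(i | P i) conjc (F i).
Proof. exact: rmorph_sum. Qed.

Lemma conjc_delta (b : bool) : conjc (b%:R : C) = b%:R.
Proof. exact: conjc_nat. Qed.

Lemma opmulA I J K L (A : op R I J) (B : op R J K) (E : op R K L) :
  opmul A (opmul B E) = opmul (opmul A B) E.
Proof.
apply: funext => i; apply: funext => l; rewrite /opmul.
under eq_bigr do rewrite mulr_sumr.
rewrite exchange_big; apply: eq_bigr => k _.
by rewrite mulr_suml; apply: eq_bigr => j _; rewrite mulrA.
Qed.

Lemma opadjK I J (A : op R I J) : opadj (opadj A) = A.
Proof. by apply: funext => i; apply: funext => j; rewrite /opadj conjcK. Qed.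

Lemma opadjM I J K (A : op R I J) (B : op R J K) :
  opadj (opmul A B) = opmul (opadj B) (opadj A).
Proof.
apply: funext => k; apply: funext => i; rewrite /opadj /opmul conjc_sum.
by apply: eq_bigr => j _; rewrite conjcM mulrC.
Qed.

Lemma opmul1l I J (A : op R I J) : opmul (@opid R I) A = A.
Proof.
by apply: funext => i; apply: funext => j; rewrite /opmul /opid sum_delta.
Qed.

Lemma opmul1r I J (A : op R I J) : opmul A (@opid R J) = A.
Proof.
apply: funext => i; apply: funext => j; rewrite /opmul /opid.
by rewrite -[RHS](sum_delta j (A i)); apply: eq_bigr => k _; rewrite mulrC eq_sym.
Qed.

Lemma optrC I J (A : op R I J) (B : op R J I) : optr (opmul A B) = optr (opmul B A).
Proof.
rewrite /optr /opmul exchange_big; apply: eq_bigr => j _.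
by apply: eq_bigr => i _; rewrite mulrC.
Qed.

Lemma psd_gram_form I J (B : op R J I) (v : I -> C) :
  \sum_i \sum_j conjc (v i) * opmul (opadj B) B i j * v j =
  \sum_k conjc (\sum_i B k i * v i) * \sum_i B k i * v i.
Proof.
under [RHS]eq_bigr do rewrite conjc_sum mulr_suml.
rewrite [RHS]exchange_big; apply: eq_bigr => i _.
under [RHS]eq_bigr do rewrite mulr_sumr.
rewrite [RHS]exchange_big; apply: eq_bigr => j _.
rewrite /opmul /opadj mulr_sumr mulr_suml; apply: eq_bigr => k _.
by rewrite conjcM !mulrA [_ * conjc (v i)]mulrC.
Qed.

Lemma psd_gram I J (B : op R J I) : oppsd (opmul (opadj B) B).
Proof.
by move=> v; rewrite psd_gram_form; apply: sumr_ge0 => k _; exact: conjM_ge0.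
Qed.

(** Polarisation: the form is real on vectors supported on two coordinates, and the test vectors
    $(1,1)$ and $(1,\mathrm{i})$ determine the real and imaginary parts that relate [A i j] to
    [A j i]. *)
Lemma psd_herm I (A : op R I I) : oppsd A -> opadj A = A.
Proof.
move=> pA.
have form2 (x y : C) i j : 0 <= conjc x * (A i i * x + A i j * y)
                              + conjc y * (A j i * x + A j j * y).
  have := pA (fun k => (i == k)%:R * x + (j == k)%:R * y).
  have E k : \sum_l A k l * ((i == l)%:R * x + (j == l)%:R * y) = A k i * x + A k j * y.
    under eq_bigr do rewrite mulrDr !(mulrCA (A _ _)).
    by rewrite big_split /= !sum_delta.
  under eq_bigr => k _.
    under eq_bigr do rewrite -mulrA.
    rewrite -mulr_sumr E conjcD !conjcM !conjc_delta mulrDl -!mulrA.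
    over.
  by rewrite big_split /= !sum_delta.
have real (z : C) : 0 <= z -> conjc z = z.
  by move=> /ger0_Im; case: z => u w /= ->; rewrite oppr0.
apply: funext => i; apply: funext => j; rewrite /opadj.
have h1 := real _ (form2 1 1 i j).
have h2 := real _ (form2 1 'i%C i j).
have h3 := real _ (form2 1 0 i i).
have h4 := real _ (form2 1 0 j j).
move: h1 h2 h3 h4.
rewrite !(conjcD, conjcM, conjc0, conjc1) ?conjcK.
case: (A i i) => a1 a2; case: (A j j) => b1 b2; case: (A i j) => c1 c2.
case: (A j i) => d1 d2; simpc => -[h1] -[h2] [h3] [h4].
by apply/eqP; rewrite eq_complex /=; apply/andP; split; apply/eqP; lra.
Qed.

End Operators.

(** * Spectral decomposition, square roots and range projections *)

Section Spectral.
Variable R : realType.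
Local Notation C := R[i].

Lemma sum_enum_val (I : finType) (F : I -> C) :
  \sum_i F i = \sum_(k < #|I|) F (enum_val k).
Proof.
rewrite (reindex (@enum_val I I)) //=.
exact: onW_bij (enum_val_bij I).
Qed.

(** Enumerating [I] turns [A] into a normal matrix, to which the spectral theorem for matrices
    applies. The conjugated rows of [U] are the eigenvectors, so $A = U^\dagger D U$. *)
Lemma op_spectral (I : finType) (A : op R I I) : opadj A = A ->
  exists (U : op R I I) (D : I -> C),
    [/\ opmul (opadj U) U = @opid R I, opmul U (opadj U) = @opid R I &
        forall i j, A i j = \sum_k conjc (U k i) * D k * U k j].
Proof.
move=> hA; pose M : 'M[C]_#|I| := \matrix_(i, j) A (enum_val i) (enum_val j).
have hM : (M ^t Num.conj)%sesqui = M.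
  apply/matrixP=> i j; rewrite !mxE.
  by have := congr1 (fun f => f (enum_val i) (enum_val j)) hA.
have /orthomx_spectralP : M \is normalmx by apply/normalmxP; rewrite hM.
set P := spectralmx M; set sp := spectral_diag M.
have uP : P \is unitarymx by exact: spectral_unitarymx.
rewrite (invmx_unitary uP) => eM.
have /unitarymxP PP := uP.
have PP' := mulmx1C PP.
exists (fun k i => P (enum_rank k) (enum_rank i)), (fun k => sp 0 (enum_rank k)).
split.
- apply: funext => i; apply: funext => j; rewrite /opmul /opadj /opid.
  have := congr1 (fun N : 'M[C]_#|I| => N (enum_rank i) (enum_rank j)) PP'.
  rewrite !mxE (inj_eq enum_rank_inj) => <-.
  rewrite sum_enum_val.
  by apply: eq_bigr => k _; rewrite enum_valK !mxE.
- apply: funext => i; apply: funext => j; rewrite /opmul /opadj /opid.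
  have := congr1 (fun N : 'M[C]_#|I| => N (enum_rank i) (enum_rank j)) PP.
  rewrite !mxE (inj_eq enum_rank_inj) => <-.
  rewrite sum_enum_val.
  by apply: eq_bigr => k _; rewrite enum_valK !mxE.
- move=> i j.
  have := congr1 (fun N : 'M[C]_#|I| => N (enum_rank i) (enum_rank j)) eM.
  rewrite mul_mx_diag !mxE !enum_rankK => ->.
  rewrite [RHS]sum_enum_val.
  by apply: eq_bigr => k _; rewrite enum_valK !mxE.
Qed.

(** The eigenvalue [D k] is the value of the form at the conjugate of row [k] of [U]. *)
Lemma psd_spectral (I : finType) (A : op R I I) : oppsd A ->
  exists (U : op R I I) (D : I -> C),
    [/\ opmul (opadj U) U = @opid R I, opmul U (opadj U) = @opid R I,
        forall k, 0 <= D k &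
        forall i j, A i j = \sum_k conjc (U k i) * D k * U k j].
Proof.
move=> pA; have [U [D [U1 U2 eA]]] := op_spectral (psd_herm pA).
exists U, D; split=> // k.
have := pA (fun i => conjc (U k i)).
suff -> : \sum_i \sum_j conjc (conjc (U k i)) * A i j * conjc (U k j) = D k by [].
have E l : \sum_i U k i * conjc (U l i) = (k == l)%:R.
  by have := congr1 (fun f => f k l) U2; rewrite /opmul /opadj.
transitivity (\sum_l (\sum_i U k i * conjc (U l i)) * D l *
                     conjc (\sum_j U k j * conjc (U l j))).
  under eq_bigr => i _.
    under eq_bigr => j _ do rewrite eA mulr_sumr mulr_suml.
    over.
  under eq_bigr do rewrite exchange_big.
  rewrite exchange_big; apply: eq_bigr => l _.
  rewrite !mulr_suml; apply: eq_bigr => i _.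
  rewrite conjc_sum mulr_sumr; apply: eq_bigr => j _.
  by rewrite conjcM !conjcK; ring.
under eq_bigr do rewrite E conjc_delta -mulrA.
by rewrite sum_delta eqxx mulr1.
Qed.

Lemma psd_factor (I : finType) (A : op R I I) : oppsd A ->
  exists B : op R I I, A = opmul (opadj B) B.
Proof.
move=> pA; have [U [D [_ _ D0 eA]]] := psd_spectral pA.
exists (fun k i => sqrtc (D k) * U k i).
apply: funext => i; apply: funext => j; rewrite eA /opmul /opadj.
apply: eq_bigr => k _; rewrite conjcM.
have -> : conjc (sqrtc (D k)) = sqrtc (D k).
  have := D0 k; rewrite -sqrtc_ge0; case: (sqrtc _) => u v.
  by rewrite lecE /= => /andP[/eqP -> _]; rewrite oppr0.
by rewrite -{1}(sqr_sqrtc (D k)) expr2; ring.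
Qed.

Lemma psd_range_proj (I : finType) (A : op R I I) : oppsd A ->
  exists P B : op R I I, [/\ opadj P = P, opmul P P = P, opmul P A = A & P = opmul A B].
Proof.
move=> pA; have [U [D [U1 U2 D0 eA]]] := psd_spectral pA.
pose dg (f : I -> C) : op R I I := fun i j => \sum_k conjc (U k i) * f k * U k j.
have E k l : \sum_i U k i * conjc (U l i) = (k == l)%:R.
  by have := congr1 (fun f => f k l) U2; rewrite /opmul /opadj.
have dgM f g : opmul (dg f) (dg g) = dg (fun k => f k * g k).
  apply: funext => i; apply: funext => j; rewrite /opmul /dg.
  under eq_bigr do rewrite mulr_suml.
  rewrite exchange_big; apply: eq_bigr => k _.
  under eq_bigr do rewrite mulr_sumr.
  rewrite exchange_big.
  transitivity (\sum_l (k == l)%:R * (conjc (U k i) * f k * g l * U l j)).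
    apply: eq_bigr => l _; rewrite -E mulr_suml; apply: eq_bigr => m _; ring.
  by rewrite sum_delta !mulrA.
have eAd : A = dg D by apply: funext => i; apply: funext => j; rewrite eA.
(* Functional calculus in the eigenbasis. The convention $0^{-1}=0$ makes the second function the
   pseudo-inverse of [A], and its product with [A] is the projector on the nonzero eigenvalues. *)
exists (dg (fun k => (D k != 0)%:R)), (dg (fun k => (D k)^-1)); split.
- apply: funext => i; apply: funext => j; rewrite /opadj /dg conjc_sum.
  by apply: eq_bigr => k _; rewrite !conjcM conjcK conjc_delta; ring.
- by rewrite dgM; congr dg; apply: funext => k; rewrite -natrM mulnb andbb.
- rewrite {1}eAd dgM eAd; congr dg; apply: funext => k.
  by have [->|] := eqVneq (D k) 0; rewrite ?mulr0 ?mul1r.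
- rewrite {1}eAd dgM; congr dg; apply: funext => k.
  by have [->|Dk] := eqVneq (D k) 0; rewrite ?mul0r ?divff.
Qed.

End Spectral.

(** * Codes from protocols built step by step *)

Section Strategies.
Variables (R : realType) (a d : nat) (rho : 'I_a -> 'M[R[i]]_d) (M : nat).
Local Notation C := R[i].

Definition jstate (X F Y : finType) := op R ((X * F) * Y)%type ((X * F) * Y)%type.

Definition play_round u (X F Y X' F' Y' : finType)
    (U : op R (cq_in (round_chan rho u) * X')%type (X * F)%type)
    (W : op R (F' * Y')%type (Y * cq_out (round_chan rho u))%type)
    (s : jstate X F Y) : jstate X' F' Y' :=
  bob_step W (channel_step (alice_step U s)).

Definition bob_marginal (X F Y : finType) (s : jstate X F Y) : op R Y Y :=
  fun y y' => \sum_(xf : (X * F)%type) s (xf, y) (xf, y').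

Definition orth_ranges (Y : finType) (s s' : op R Y Y) :=
  forall v w, oprange s v -> oprange s' w -> \sum_y conjc (v y) * w y = 0.

Definition tcons (x : nat) (xs : nat -> nat) (t : nat) : nat :=
  if t is t'.+1 then xs t' else x.

(** A code stripped of its initial state and of its isometry conditions. Index [t] of [sx], [sf],
    [sy] is the dimension after round [t]; prepending the initial dimension with [tcons] gives, by
    conversion, the sequences that [fcode] expects. *)
Record strategy (x f y : nat) := Strategy {
  ssched : nat -> bool;
  sx : nat -> nat; sf : nat -> nat; sy : nat -> nat;
  sU : forall (m : 'I_M) (t : nat),
    op R (cq_in (round_chan rho (ssched t)) * 'I_(sx t))%type
         ('I_(tcons x sx t) * 'I_(tcons f sf t))%type;
  sW : forall t : nat,
    op R ('I_(sf t) * 'I_(sy t))%type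
         ('I_(tcons y sy t) * cq_out (round_chan rho (ssched t)))%type }.

Arguments sU {x f y}.
Arguments sW {x f y}.

Fixpoint run x f y (S : strategy x f y) (m : 'I_M) (s : jstate 'I_x 'I_f 'I_y) (t : nat) :
    jstate 'I_(tcons x (sx S) t) 'I_(tcons f (sf S) t) 'I_(tcons y (sy S) t) :=
  match t with
  | 0 => s
  | t'.+1 => play_round (sU S m t') (sW S t') (@run x f y S m s t')
  end.

Arguments run {x f y} S m s t.

Definition scons u x f y x' f' y'
    (U : 'I_M -> op R (cq_in (round_chan rho u) * 'I_x')%type ('I_x * 'I_f)%type)
    (W : op R ('I_f' * 'I_y')%type ('I_y * cq_out (round_chan rho u))%type)
    (S : strategy x' f' y') : strategy x f y :=
  @Strategy x f y (fun t => if t is t'.+1 then ssched S t' else u)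
    (tcons x' (sx S)) (tcons f' (sf S)) (tcons y' (sy S))
    (fun m t => match t with 0 => U m | t'.+1 => sU S m t' end)
    (fun t => match t with 0 => W | t'.+1 => sW S t' end).

Arguments scons {u x f y x' f' y'} U W S.

Lemma run_scons u x f y x' f' y' U W (S : strategy x' f' y') m s t :
  run (@scons u x f y x' f' y' U W S) m s t.+1 = run S m (play_round (U m) W s) t.
Proof. by elim: t => [//|t IH]; rewrite /= -IH. Qed.

(* Protocols are built from the last round backwards, so that the dimensions of the
   remaining rounds never have to be cast. *)
Inductive winning : seq bool -> forall x f y : nat, ('I_M -> jstate 'I_x 'I_f 'I_y) -> Prop :=
| Winning_nil x f y s :
    (forall m m', m != m' -> orth_ranges (bob_marginal (s m)) (bob_marginal (s m'))) ->
    @winning [::] x f y s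
| Winning_cons u l x f y x' f' y' U W s :
    (forall m, is_isometry (U m)) -> is_isometry W ->
    @winning l x' f' y' (fun m => @play_round u 'I_x 'I_f 'I_y _ _ _ (U m) W (s m)) ->
    @winning (u :: l) x f y s.

Lemma winning_strategy l x f y s : @winning l x f y s ->
  exists S : strategy x f y,
    [/\ mkseq (ssched S) (size l) = l,
        forall m t, (t < size l)%N -> is_isometry (sU S m t),
        forall t, (t < size l)%N -> is_isometry (sW S t) &
        forall m m', m != m' ->
          orth_ranges (bob_marginal (run S m (s m) (size l)))
                      (bob_marginal (run S m' (s m') (size l)))].
Proof.
elim=> {l x f y s} [x f y s orth|u l x f y x' f' y' U W s isoU isoW _ [S [schS isU isW oS]]].
  (* No round remains, so a placeholder with zero operators serves; none of its rounds is ever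
     played. *)
  have S : strategy x f y.
    apply: (@Strategy x f y (fun=> false) (fun=> 0) (fun=> 0) (fun=> 0)).
    - by move=> *; exact: (fun=> fun=> 0).
    - by move=> *; exact: (fun=> fun=> 0).
  by exists S; split.
exists (scons U W S); split.
- by rewrite /mkseq /= -[1%N]add1n iotaDl -map_comp -[in RHS]schS.
- by move=> m [|t] //= /isU.
- by move=> [|t] //= /isW.
- by move=> m m' mm'; rewrite [size _]/= !run_scons; exact: oS.
Qed.

Lemma winning_code l x f y (phi : ('I_x * 'I_f) * 'I_y -> C) n b :
  f = 1%N ->
  \sum_z conjc (phi z) * phi z = 1 ->
  size l = (n + b)%N -> count id l = n ->
  @winning l x f y (fun=> fun p q => phi p * conjc (phi q)) ->
  exists c : @fcode R a d rho n b M, zero_error c.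
Proof.
move=> f1 phi1 sl cl /winning_strategy [S [schS isU isW oS]].
have sc : count (ssched S) (iota 0 (n + b)) = n.
  by rewrite -sl -[RHS]cl -[in RHS]schS /mkseq count_map; apply: eq_count.
have isU' m t : (t < n + b)%N -> is_isometry (sU S m t) by rewrite -sl; exact: isU.
have isW' t : (t < n + b)%N -> is_isometry (sW S t) by rewrite -sl; exact: isW.
pose c := @FCode R a d rho n b M (ssched S) sc (tcons x (sx S)) (tcons f (sf S))
  (tcons y (sy S)) f1 phi phi1 (sU S) isU' (sW S) isW'.
exists c.
have E m t : @code_state R a d rho n b M c m t = run S m (fun p q => phi p * conjc (phi q)) t.
  by elim: t => [//|t IH]; rewrite /= IH.
move=> m m' mm' v w; rewrite /bob_final !E.
by move: v w; have := oS _ _ mm'; rewrite sl.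
Qed.

(** The registers below are arbitrary finite types such as sets of candidates or strings; codes
    demand ordinals, hence this relabelling. *)
Definition to_ord (X F Y : finType) (s : jstate X F Y) : jstate 'I_#|X| 'I_#|F| 'I_#|Y| :=
  fun p q => s ((enum_val p.1.1, enum_val p.1.2), enum_val p.2)
               ((enum_val q.1.1, enum_val q.1.2), enum_val q.2).

Definition wins l (X F Y : finType) (s : 'I_M -> jstate X F Y) : Prop :=
  winning l (fun m => to_ord (s m)).

Lemma sum_enum_pair (X F : finType) (G : X * F -> C) :
  \sum_xf G xf = \sum_(p : 'I_#|X| * 'I_#|F|) G (enum_val p.1, enum_val p.2).
Proof.
rewrite (reindex (fun p : 'I_#|X| * 'I_#|F| => (enum_val p.1, enum_val p.2))) //=.
apply: onW_bij; exists (fun q => (enum_rank q.1, enum_rank q.2)).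
  by case=> p q; rewrite /= !enum_valK.
by case=> p q; rewrite /= !enum_rankK.
Qed.

Lemma sum_enum_r (A X : finType) (G : A * X -> C) :
  \sum_xf G xf = \sum_(p : A * 'I_#|X|) G (p.1, enum_val p.2).
Proof.
rewrite (reindex (fun p : A * 'I_#|X| => (p.1, enum_val p.2))) //=.
apply: onW_bij; exists (fun q => (q.1, enum_rank q.2)).
  by case=> p q; rewrite /= !enum_valK.
by case=> p q; rewrite /= !enum_rankK.
Qed.

(** A vector in the range of Bob's state is supported on labels of nonzero rows. When these labels
    are disjoint for distinct messages, the ranges are orthogonal. *)
Lemma wins_nil (X F Y : finType) (s : 'I_M -> jstate X F Y) :
  (forall m m' p q p' q', m != m' -> s m p q != 0 -> s m' p' q' != 0 -> p.2 != p'.2) ->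
  wins [::] s.
Proof.
move=> dis; apply: Winning_nil => m m' mm' v w [v' ->] [w' ->].
apply: big1 => y _; apply/eqP; rewrite mulf_eq0 conjc_eq0.
apply: contrapT => /negP; rewrite negb_or => /andP[].
have nz (G : 'I_#|Y| -> C) (g : 'I_#|Y| -> C) : \sum_j G j * g j != 0 -> exists j, G j != 0.
  move=> nz; apply: contrapT => no; move/eqP: nz; apply.
  rewrite big1 // => j _; have [->|Gj] := eqVneq (G j) 0; first by rewrite mul0r.
  by case: no; exists j.
have nz2 m0 j : bob_marginal (to_ord (s m0)) y j != 0 ->
    exists p q, s m0 p q != 0 /\ p.2 = enum_val y.
  move=> h; apply: contrapT => no; move/eqP: h; apply.
  rewrite /bob_marginal big1 // => xf _; apply: contrapT => /eqP h; apply: no.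
  by eexists; eexists; split; first exact: h.
move=> /nz[j /nz2 [p [q [spq p2]]]] /nz[j' /nz2 [p' [q' [spq' p2']]]].
by have := dis _ _ _ _ _ _ mm' spq spq'; rewrite p2 p2' eqxx.
Qed.

Lemma wins_cons u l (X F Y X' F' Y' : finType) U W (s : 'I_M -> jstate X F Y) :
    (forall m, is_isometry (U m)) -> is_isometry W ->
    wins l (fun m => @play_round u X F Y X' F' Y' (U m) W (s m)) ->
  wins (u :: l) s.
Proof.
move=> isoU isoW win.
pose U' m : op R (cq_in (round_chan rho u) * 'I_#|X'|)%type ('I_#|X| * 'I_#|F|)%type :=
  fun p q => U m (p.1, enum_val p.2) (enum_val q.1, enum_val q.2).
pose W' : op R ('I_#|F'| * 'I_#|Y'|)%type ('I_#|Y| * cq_out (round_chan rho u))%type :=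
  fun p q => W (enum_val p.1, enum_val p.2) (enum_val q.1, q.2).
apply: (@Winning_cons u l _ _ _ _ _ _ U' W').
- move=> m; apply: funext => p; apply: funext => q.
  have := congr1 (fun f => f (enum_val p.1, enum_val p.2) (enum_val q.1, enum_val q.2)) (isoU m).
  rewrite /opmul /opadj /opid /U' xpair_eqE !(inj_eq enum_val_inj) -xpair_eqE.
  by rewrite -!surjective_pairing sum_enum_r.
- apply: funext => p; apply: funext => q.
  have := congr1 (fun f => f (enum_val p.1, p.2) (enum_val q.1, q.2)) isoW.
  rewrite /opmul /opadj /opid /W' xpair_eqE !(inj_eq enum_val_inj) -xpair_eqE.
  by rewrite -!surjective_pairing sum_enum_pair.
suff -> : (fun m => play_round (U' m) W' (to_ord (s m))) =
    (fun m => to_ord (play_round (U m) W (s m))) by [].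
apply: funext => m; apply: funext => p; apply: funext => q.
have alice p1 q1 : alice_step (U' m) (to_ord (s m)) p1 q1 =
    alice_step (U m) (s m) ((p1.1.1, enum_val p1.1.2), enum_val p1.2)
                           ((q1.1.1, enum_val q1.1.2), enum_val q1.2).
  rewrite /alice_step [RHS]sum_enum_pair; apply: eq_bigr => xf _.
  by rewrite [RHS]sum_enum_pair.
rewrite /play_round /to_ord /bob_step [RHS]sum_enum_val; apply: eq_bigr => y _.
apply: eq_bigr => o _; rewrite [RHS]sum_enum_val; apply: eq_bigr => y' _.
apply: eq_bigr => o' _; rewrite /channel_step /W' /=.
by congr (_ * _ * _); apply: eq_bigr => i _; rewrite alice.
Qed.

End Strategies.

Lemma tuple_consP (T : Type) n (u : n.+1.-tuple T) :
  exists o (u' : n.-tuple T), u = [tuple of o :: u'].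
Proof. by case/tupleP: u => o u'; exists o, u'. Qed.

Lemma big_tuple_cons (R : Type) (idx : R) (op : Monoid.com_law idx) (T : finType) n
    (G : n.+1.-tuple T -> R) :
  \big[op/idx]_u G u = \big[op/idx]_o \big[op/idx]_(u : n.-tuple T) G [tuple of o :: u].
Proof.
rewrite pair_bigA (reindex (fun p : T * n.-tuple T => [tuple of p.1 :: p.2])) //=.
apply: onW_bij; exists (fun u : n.+1.-tuple T => (thead u, [tuple of behead u])).
  by case=> o u; rewrite theadE; congr (_, _); apply: val_inj.
by move=> u; rewrite -tuple_eta.
Qed.

Lemma prodstate_cons (R : realType) (a d : nat) (rho : 'I_a -> 'M[R[i]]_d) n
    (c : 'I_a) (s : n.-tuple 'I_a) (o o' : 'I_d) (u v : n.-tuple 'I_d) :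
  prodstate rho [tuple of c :: s] [tuple of o :: u] [tuple of o' :: v] =
  rho c o o' * prodstate rho s u v.
Proof.
rewrite /prodstate big_ord_recl !tnth0; congr (_ * _).
by apply: eq_bigr => k _; rewrite !tnthS.
Qed.

Lemma eq_cons_tuple (T : eqType) n (o o' : T) (u v : n.-tuple T) :
  ([tuple of o :: u] == [tuple of o' :: v]) = (o == o') && (u == v).
Proof. by rewrite -!val_eqE /= eqseq_cons. Qed.

(** * The phases of the protocol, last one first: noiseless bits, measurement, letters *)

Section Phases.
Variables (R : realType) (a d : nat) (rho : 'I_a -> 'M[R[i]]_d) (M : nat).
Local Notation C := R[i].

Lemma sum_neq0 (I : finType) (G : I -> C) : \sum_i G i != 0 -> exists i, G i != 0.
Proof.
move=> nz; apply: contrapT => no; move/eqP: nz; apply.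
rewrite big1 // => j _; have [->//|Gj] := eqVneq (G j) 0.
by case: no; exists j.
Qed.

Lemma sum_pair (I J : finType) (G : I * J -> C) :
  \sum_p G p = \sum_i \sum_j G (i, j).
Proof. by rewrite pair_bigA; apply: eq_bigr => -[]. Qed.

Lemma bob_step_store (B X Y : finType) (s : op R (B * X * Y)%type (B * X * Y)%type) p q :
  bob_step (fun (f : unit * (Y * B)) j => (f.1 == tt)%:R * @opid R _ f.2 j) s p q =
  s ((p.2.2, p.1.1), p.2.1) ((q.2.2, q.1.1), q.2.1).
Proof.
rewrite /bob_step /=; case: p => -[x []] [y o]; case: q => -[x' []] [y' o'] /=.
transitivity (\sum_yo \sum_yo' ((y, o) == yo)%:R * (((y', o') == yo')%:R *
   s ((yo.2, x), yo.1) ((yo'.2, x'), yo'.1))).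
  rewrite sum_pair; apply: eq_bigr => y1 _; apply: eq_bigr => o1 _.
  rewrite sum_pair; apply: eq_bigr => y2 _; apply: eq_bigr => o2 _ /=.
  by rewrite /opid !mul1r conjc_delta mulrA mulrAC.
under eq_bigr do rewrite -mulr_sumr sum_delta.
by rewrite sum_delta.
Qed.

Lemma isometry_fun (I J : finType) (f : J -> I) : injective f ->
  is_isometry (fun i j => (i == f j)%:R : C).
Proof.
move=> injf; apply: funext => j; apply: funext => j'; rewrite /opmul /opadj /opid.
under eq_bigr do rewrite conjc_delta eq_sym.
by rewrite sum_delta (inj_eq injf).
Qed.

(** A coherent copy $|y\rangle\mapsto|g(y)\rangle|y\rangle$: it lets Bob feed back a function of his
    basis label while acting isometrically. *)
Lemma isometry_copy (J F Y : finType) (g : Y -> F) (V : op R Y J) : is_isometry V ->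
  is_isometry (fun (p : F * Y) j => (p.1 == g p.2)%:R * V p.2 j).
Proof.
move=> isoV; apply: funext => j; apply: funext => j'.
rewrite -isoV /opmul /opadj.
rewrite -(pair_bigA _ (fun f y => conjc ((f == g y)%:R * V y j) * ((f == g y)%:R * V y j'))).
rewrite exchange_big; apply: eq_bigr => y _ /=.
under eq_bigr do rewrite conjcM conjc_delta eq_sym mulrACA -natrM mulnb andbb.
by rewrite sum_delta.
Qed.

Lemma isometry_tensor_id (I J B : finType) (V : op R I J) : is_isometry V ->
  is_isometry (fun (p : I * B) (q : J * B) => V p.1 q.1 * (p.2 == q.2)%:R).
Proof.
move=> isoV; apply: funext => -[j b]; apply: funext => -[j' b'].
rewrite /opmul /opadj /opid xpair_eqE.
rewrite -(pair_bigA _ (fun i e => conjc (V i j * (e == b)%:R) * (V i j' * (e == b')%:R))) /=.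
transitivity (\sum_i (conjc (V i j) * V i j') * (b == b')%:R).
  apply: eq_bigr => i _.
  under eq_bigr do rewrite conjcM conjc_delta mulrACA mulrC eq_sym -mulrA.
  by rewrite sum_delta mulrC.
rewrite -mulr_suml; have := congr1 (fun f => f j j') isoV; rewrite /opmul /opadj /opid => ->.
by rewrite -natrM mulnb.
Qed.

(** Traces a nonzero entry back through one round, so that invariants on basis labels can be
    followed without computing amplitudes. *)
Lemma play_round_neq0 u (X F Y X' F' Y' : finType) U W (s : jstate R X F Y) p q :
  @play_round R a d rho u X F Y X' F' Y' U W s p q != 0 ->
  exists y o o' i xf q',
    [/\ W (p.1.2, p.2) (y, o) != 0, cq_st i o o' != 0, U (i, p.1.1) xf != 0 &
        s (xf, y) q' != 0].
Proof.
rewrite /play_round /bob_step /channel_step /alice_step.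
move=> /sum_neq0[y] /sum_neq0[o] /sum_neq0[y'] /sum_neq0[o'].
rewrite !mulf_eq0 !negb_or => /andP[/andP[Wn]].
move=> H; have [i {H}] := sum_neq0 H; rewrite mulf_eq0 negb_or => /andP[sti].
move=> /sum_neq0[xf] /sum_neq0[xf'].
rewrite !mulf_eq0 !negb_or => /andP[/andP[Un sn] _] _.
by exists y, o, o', i, xf, (xf', y').
Qed.

Lemma wins_bits k : forall (X Y : finType) (s : 'I_M -> jstate R X {set 'I_M} Y)
    (cand : Y -> {set 'I_M}),
  (forall m p q, s m p q != 0 -> p.1.2 = cand p.2 /\ m \in cand p.2) ->
  (forall y, #|cand y| <= k.+1)%N -> wins rho (nseq k false) s.
Proof.
elim: k => [|k IH] X Y s cand supp small.
  apply: wins_nil => m m' p q p' q' mm' /supp[_ mp] /supp[_ mp'].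
  apply: contraNneq mm' => pp'; rewrite -pp' in mp'.
  by apply/eqP; have /card_le1_eqP := small p.2; apply.
pose head (S : {set 'I_M}) := [pick i in S].
pose bit m (S : {set 'I_M}) : 'I_2 := if head S == Some m then ord_max else ord0.
pose cand' (z : Y * 'I_2) : {set 'I_M} :=
  if head (cand z.1) is Some h then
    if z.2 == ord_max then [set h] else cand z.1 :\ h
  else finset.set0.
(* Alice keeps her memory and the received list and merely appends the bit, an injective map of
   basis states. Bob stores the bit and feeds back the updated list. *)
apply: (wins_cons (u := false) (X' := (X * {set 'I_M})%type) (F' := {set 'I_M})
  (Y' := (Y * 'I_2)%type) (U := fun m p xf => (p == (bit m xf.2, xf))%:R)
  (W := fun p j => (p.1 == cand' p.2)%:R * @opid R _ p.2 j)).
- by move=> m; apply: isometry_fun => xf xf' [].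
- by apply: isometry_copy; rewrite /is_isometry; apply: funext => i; apply: funext => j;
    rewrite /opmul /opadj /opid; under eq_bigr do rewrite conjc_delta eq_sym; rewrite sum_delta.
apply: (IH _ _ _ cand').
  move=> m p q /play_round_neq0[y [o [o' [i [xf [q']]]]]] [Wn /= stn Un /supp[/= xfy my]].
  have {Un} : (i, p.1.1) == (bit m xf.2, xf).
    by apply: contraNT Un => /negbTE ->.
  rewrite xpair_eqE => /andP[/eqP ei _].
  have {stn} oi : o = i by apply/eqP; apply: contraNT stn => /negbTE ->.
  move: Wn; rewrite /opid mulf_eq0 negb_or /= => /andP[].
  rewrite !pnatr_eq0 !eqb0 !negbK => /eqP -> /eqP ->; split=> //.
  rewrite /cand' oi ei xfy /= /bit.
  rewrite /head; case: pickP => [h hy|/(_ m)]; last by rewrite my.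
  have [[<-]|hm] := eqVneq (Some h) (Some m); first by rewrite eqxx inE.
  by rewrite /= !inE my andbT; apply: contraNneq hm => ->.
move=> [y o]; rewrite /cand' /= /head; case: pickP => [h hy|]; last by rewrite cards0.
case: ifP => _; first by rewrite cards1.
by have := small y; rewrite (cardsD1 h) hy.
Qed.

Variables (k : nat) (Omega : finType) (cand : Omega -> {set 'I_M}).
Hypothesis cand_small : forall w, (#|cand w| <= k.+1)%N.

Lemma sum_unit2 (G : unit * unit -> C) : \sum_xf G xf = G (tt, tt).
Proof. by rewrite (big_pred1 (tt, tt)) // => -[[] []]. Qed.

(* The bit sent in this round is idle; Bob uses the round to measure. *)
Lemma wins_measure (Y : finType) (tau : 'I_M -> op R Y Y) (V : op R Omega Y) :
  is_isometry V ->
  (forall m w, m \notin cand w -> forall y', \sum_y V w y * tau m y y' = 0) ->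
  wins rho (false :: nseq k false) (fun m (p q : unit * unit * Y) => tau m p.2 q.2).
Proof.
move=> isoV kill.
apply: (wins_cons (u := false) (X' := unit) (F' := {set 'I_M})
  (Y' := (Omega * 'I_2)%type) (U := fun m p xf => (p == (ord0, tt))%:R)
  (W := fun p j => (p.1 == cand p.2.1)%:R * (V p.2.1 j.1 * (p.2.2 == j.2)%:R))).
- by move=> m; apply: (@isometry_fun _ _ (fun=> (ord0, tt))) => -[[] []] [[] []].
- have := isometry_copy (fun p : Omega * 'I_2 => cand p.1) (isometry_tensor_id _ isoV).
  by apply.
apply: (@wins_bits _ _ _ _ (fun p => cand p.1)) => [m p q nz|p]; last exact: cand_small.
split.
  have [y [o [o' [i [xf [q']]]]]] := play_round_neq0 nz.
  by case=> + _ _ _; rewrite /= mulf_eq0 negb_or pnatr_eq0 eqb0 negbK => /andP[/eqP].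
apply: contraNT nz => mw; rewrite /play_round /bob_step.
rewrite exchange_big big1 //= => o _.
rewrite exchange_big big1 //= => y' _.
rewrite exchange_big big1 //= => o' _.
(* All factors that do not depend on [y] are collected; the remaining sum over [y] is the amplitude
   that vanishes for an excluded message. *)
pose coef := (p.1.2 == cand p.2.1)%:R * (p.2.2 == o)%:R *
   (\sum_(i : 'I_2) cq_st (c := bitchan R) i o o' *
     (((i, p.1.1) == (ord0, tt))%:R * conjc ((i, q.1.1) == (ord0, tt))%:R)) *
   conjc ((q.1.2 == cand q.2.1)%:R * (V q.2.1 y' * (q.2.2 == o')%:R)).
transitivity (\sum_y (V p.2.1 y * tau m y y') * coef).
  apply: eq_bigr => y _; rewrite /channel_step /= /alice_step.
  under eq_bigr => i _ do rewrite !sum_unit2 (mulrAC _ (tau m y y')) mulrA.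
  rewrite -mulr_suml /coef /=.
  ring.
by rewrite -mulr_suml kill // mul0r.
Qed.

(** Bob only stores the outputs while letters arrive, with trivial feedback, and measures once at
    the end. In the induction one received output moves from the tensor factor of strings into his
    register. *)
Lemma wins_letters r : forall (Y : finType) (tau : 'I_M -> op R Y Y)
    (c : 'I_M -> r.-tuple 'I_a) (V : op R Omega (Y * r.-tuple 'I_d)%type),
  is_isometry V ->
  (forall m w, m \notin cand w -> forall y' u',
     \sum_yu V w yu * (tau m yu.1 y' * prodstate rho (c m) yu.2 u') = 0) ->
  wins rho (nseq r true ++ false :: nseq k false)
    (fun m (p q : unit * unit * Y) => tau m p.2 q.2).
Proof.
elim: r => [|r IH] Y tau c V isoV kill.
  apply: (@wins_measure _ _ (fun w y => V w (y, [tuple]))).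
    apply: funext => y; apply: funext => y'.
    have := congr1 (fun f => f (y, [tuple]) (y', [tuple])) isoV.
    by rewrite /opmul /opadj /opid xpair_eqE eqxx andbT.
  move=> m w mw y'; rewrite -[RHS](kill m w mw y' [tuple]).
  rewrite sum_pair.
  apply: eq_bigr => y _; rewrite (big_pred1 [tuple]) /=; last by move=> u; rewrite [u]tuple0; apply/esym/eqP; exact: val_inj.
  by rewrite /prodstate big_ord0 mulr1.
apply: (wins_cons (u := true) (X' := unit) (F' := unit)
  (Y' := (Y * 'I_d)%type) (U := fun m p xf => (p == (thead (c m), tt))%:R)
  (W := fun p j => (p.1 == tt)%:R * @opid R _ p.2 j)).
- by move=> m; apply: (@isometry_fun _ _ (fun=> (thead (c m), tt))) => -[[] []] [[] []].
- apply: (@isometry_copy _ _ _ (fun=> tt)).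
  by rewrite /is_isometry; apply: funext => i; apply: funext => j;
    rewrite /opmul /opadj /opid; under eq_bigr do rewrite conjc_delta eq_sym; rewrite sum_delta.
(* Bob's register after the round: the old state tensored with the output state of the first
   letter. *)
pose tau' m : op R (Y * 'I_d)%type (Y * 'I_d)%type :=
  fun p q => tau m p.1 q.1 * rho (thead (c m)) p.2 q.2.
set st := (X in wins _ _ X).
have -> : st = fun m (p q : unit * unit * (Y * 'I_d)) => tau' m p.2 q.2.
  apply: funext => m; apply: funext => -[[[] []] [y o]]; apply: funext => -[[[] []] [y' o']].
  rewrite /st /play_round bob_step_store /channel_step /alice_step /=.
  under eq_bigr => i _ do rewrite !sum_unit2 conjc_delta mulrAC -natrM mulnb andbb
    mulrCA xpair_eqE andbT eq_sym.
  by rewrite sum_delta /tau' mulrC.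
apply: (IH _ _ (fun m => [tuple of behead (c m)])
   (fun w p => V w (p.1.1, [tuple of p.1.2 :: p.2]))).
  apply: funext => -[[y o] u]; apply: funext => -[[y' o'] u'].
  have := congr1 (fun f => f (y, [tuple of o :: u]) (y', [tuple of o' :: u'])) isoV.
  by rewrite /opmul /opadj /opid !xpair_eqE eq_cons_tuple andbA.
move=> m w mw [y' o'] u'; rewrite -[RHS](kill m w mw y' [tuple of o' :: u']).
rewrite !sum_pair.
apply: eq_bigr => y _; rewrite big_tuple_cons; apply: eq_bigr => o _.
apply: eq_bigr => u _; rewrite [in RHS](tuple_eta (c m)) prodstate_cons /tau' /=.
by rewrite !mulrA.
Qed.

End Phases.

(** * Concatenated list decoding *)

Section TupleCat.
Variables (T : finType) (n1 n2 : nat).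

Definition tuple_left (u : (n1 + n2).-tuple T) : n1.-tuple T := [tuple tnth u (lshift n2 i) | i < n1].
Definition tuple_right (u : (n1 + n2).-tuple T) : n2.-tuple T := [tuple tnth u (rshift n1 i) | i < n2].

Lemma tuple_left_cat (u1 : n1.-tuple T) (u2 : n2.-tuple T) : tuple_left (cat_tuple u1 u2) = u1.
Proof. by apply: eq_from_tnth => i; rewrite tnth_mktuple tnth_lshift. Qed.

Lemma tuple_right_cat (u1 : n1.-tuple T) (u2 : n2.-tuple T) : tuple_right (cat_tuple u1 u2) = u2.
Proof. by apply: eq_from_tnth => i; rewrite tnth_mktuple tnth_rshift. Qed.

Lemma cat_tuple_bij : bijective (fun p : n1.-tuple T * n2.-tuple T => cat_tuple p.1 p.2).
Proof.
apply: inj_card_bij; last by rewrite card_prod !card_tuple expnD.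
move=> [u1 u2] [v1 v2] /= E; congr (_, _).
  by rewrite -(tuple_left_cat u1 u2) E tuple_left_cat.
by rewrite -(tuple_right_cat u1 u2) E tuple_right_cat.
Qed.

Lemma big_tuple_cat (V : nmodType) (G : (n1 + n2).-tuple T -> V) :
  \sum_u G u = \sum_u1 \sum_u2 G (cat_tuple u1 u2).
Proof.
rewrite pair_bigA (reindex (fun p : n1.-tuple T * n2.-tuple T => cat_tuple p.1 p.2)) //=.
exact: onW_bij cat_tuple_bij.
Qed.
End TupleCat.

(** * Product states and positivity of matrices as operators *)

Section ProductStates.
Variables (R : realType) (a d : nat).
Local Notation C := R[i].
Implicit Types P Q : 'I_a -> 'M[C]_d.

Lemma prodstate_cat P n1 n2 (s1 : n1.-tuple 'I_a) (s2 : n2.-tuple 'I_a)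
    (u v : (n1 + n2).-tuple 'I_d) :
  prodstate P (cat_tuple s1 s2) u v =
  prodstate P s1 (tuple_left u) (tuple_left v) * prodstate P s2 (tuple_right u) (tuple_right v).
Proof.
rewrite /prodstate big_split_ord; congr (_ * _); apply: eq_bigr => k _.
  by rewrite tnth_lshift !tnth_mktuple.
by rewrite tnth_rshift !tnth_mktuple.
Qed.

Lemma prodstate_mul P Q n (s : n.-tuple 'I_a) :
  opmul (prodstate P s) (prodstate Q s) = prodstate (fun i => P i *m Q i) s.
Proof.
apply: funext => u; apply: funext => v; rewrite /opmul.
elim: n s u v => [|n IH] s u v.
  rewrite /prodstate (big_pred1 [tuple]) ?big_ord0 ?mulr1 //.
  by move=> w; rewrite [w]tuple0; apply/esym/eqP; exact: val_inj.
have [c [s' ->]] := tuple_consP s; have [o [u' ->]] := tuple_consP u.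
have [o' [v' ->]] := tuple_consP v.
rewrite prodstate_cons big_tuple_cons mxE mulr_suml; apply: eq_bigr => e _.
rewrite -IH mulr_sumr; apply: eq_bigr => w _.
by rewrite !prodstate_cons mulrACA.
Qed.

Lemma prodstate_adj P n (s : n.-tuple 'I_a) :
  opadj (prodstate P s) = prodstate (fun i => adjmx (P i)) s.
Proof.
apply: funext => u; apply: funext => v; rewrite /opadj /prodstate.
rewrite (rmorph_prod (@conjc R)); apply: eq_bigr => k _.
by rewrite /adjmx !mxE.
Qed.

Lemma eq_prodstate P Q n (s : n.-tuple 'I_a) : P =1 Q -> prodstate P s = prodstate Q s.
Proof.
by move=> PQ; apply: funext => u; apply: funext => v; apply: eq_bigr => k _; rewrite PQ.
Qed.

Lemma cdotE n (v w : 'cV[C]_n) : cdot v w = \sum_i conjc (v i 0) * w i 0.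
Proof. by rewrite /cdot /adjmx mxE; apply: eq_bigr => i _; rewrite !mxE. Qed.

Lemma cdot_mulmx n (A : 'M[C]_n) (v : 'cV[C]_n) :
  cdot v (A *m v) = \sum_i \sum_j conjc (v i 0) * A i j * v j 0.
Proof.
rewrite cdotE; apply: eq_bigr => i _; rewrite mxE mulr_sumr.
by apply: eq_bigr => j _; rewrite mulrA.
Qed.

Lemma psdmx_op n (A : 'M[C]_n) : psdmx A <-> oppsd (fun i j => A i j).
Proof.
split=> pA v; last by rewrite cdot_mulmx; exact: pA.
have := pA (\col_i v i); rewrite cdot_mulmx.
by under eq_bigr => i _ do under eq_bigr => j _ do rewrite !mxE.
Qed.

Lemma psdmx_factor n (A : 'M[C]_n) : psdmx A -> exists B : 'M[C]_n, A = adjmx B *m B.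
Proof.
move=> /psdmx_op /psd_factor[B eA]; exists (\matrix_(i, j) B i j).
apply/matrixP => i j; have := congr1 (fun f => f i j) eA => /= ->.
by rewrite /opmul /opadj mxE; apply: eq_bigr => k _; rewrite /adjmx !mxE.
Qed.

Lemma optr_gram_eq0 (I J : finType) (X : op R I J) :
  optr (opmul (opadj X) X) = 0 -> forall i j, X i j = 0.
Proof.
rewrite /optr /opmul /opadj => /eqP; rewrite psumr_eq0; last first.
  by move=> j _; apply: sumr_ge0 => i _; exact: conjM_ge0.
move=> /allP h i j; have := h j (mem_index_enum _).
rewrite /= psumr_eq0 => [/allP /(_ i (mem_index_enum _))|k _]; last exact: conjM_ge0.
by rewrite /= mulf_eq0 conjc_eq0 orbb => /eqP.
Qed.

Variables (rho : 'I_a -> 'M[C]_d) (n : nat).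

(** With $\rho_s = A^\dagger A$ the trace is $\mathrm{tr}\,(AK^\dagger)^\dagger(AK^\dagger)$, so
    $AK^\dagger=0$ and $K\rho_s = (AK^\dagger)^\dagger A = 0$. Excluded outcomes thus vanish at the
    level of amplitudes. *)
Lemma excluded_kills (s : n.-tuple 'I_a) (K : op R (n.-tuple 'I_d) (n.-tuple 'I_d)) :
  (forall i, psdmx (rho i)) ->
  optr (opmul (prodstate rho s) (opmul (opadj K) K)) = 0 ->
  forall e u', \sum_u K e u * prodstate rho s u u' = 0.
Proof.
move=> prho tr0 e u'.
have [B eB] := choice (fun i => psdmx_factor (prho i)).
pose A := prodstate B s.
have eA : prodstate rho s = opmul (opadj A) A.
  by rewrite prodstate_adj prodstate_mul; apply: eq_prodstate.
have X0 : forall i j, opmul A (opadj K) i j = 0.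
  apply: optr_gram_eq0; rewrite opadjM opadjK.
  by rewrite -opmulA (opmulA (opadj A)) -eA optrC -opmulA.
have -> : \sum_u K e u * prodstate rho s u u' = opmul K (prodstate rho s) e u' by [].
rewrite eA opmulA; apply: big1 => x _.
have -> : opmul K (opadj A) e x = conjc (opmul A (opadj K) x e).
  by have := congr1 (fun f => f e x) (opadjM A (opadj K)); rewrite opadjK => <-.
by rewrite X0 conjc0 mul0r.
Qed.

End ProductStates.

(** * Separating columns, by averaging over all columns *)

Section HashColumns.
Variables (S : finType) (M : nat).
Implicit Types (col : {ffun 'I_M -> S}) (g : {ffun S -> 'I_M}).
Local Notation N := #|S|.

(* Any bijective pattern of [col] on the range of [g] would do; fixing one of them
   only lowers the frequency of separating columns to [N ^ -N]. *)
Definition separates col g : bool := [forall s, col (g s) == s].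

(** Overwriting a column on the range of [g] makes it separating, and the column is recovered from
    the result together with the [N] overwritten values, which form one of $N^N$ patterns. *)
Lemma card_separating g : injective g ->
  (N ^ M <= #|[set col | separates col g]| * N ^ N)%N.
Proof.
move=> injg.
pose fixup col : {ffun 'I_M -> S} :=
  [ffun m => if [pick s | g s == m] is Some s then s else col m].
pose f col := (fixup col, [ffun s => col (g s)]).
have injf : injective f.
  move=> c c' [E1 E2]; apply/ffunP => m.
  have := congr1 (fun h : {ffun _} => h m) E1; rewrite /fixup !ffunE.
  case: pickP => // s /eqP <- _.
  by have := congr1 (fun h : {ffun _} => h s) E2; rewrite !ffunE.
have -> : (N ^ M = #|f @: [set: {ffun 'I_M -> S}]|)%N.
  by rewrite card_imset // cardsT card_ffun card_ord.
have -> : (N ^ N = #|[set: {ffun S -> S}]|)%N by rewrite cardsT card_ffun.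
rewrite -cardsX; apply: subset_leq_card; apply/fintype.subsetP => _ /imsetP[c _ ->].
rewrite inE /= !inE andbT; apply/forallP => s; rewrite ffunE.
by case: pickP => [s' /eqP/injg ->|/(_ s)]; rewrite ?eqxx.
Qed.

(** Double counting of pairs of a column and a map it separates: every [g] is separated by a
    fraction of at least $N^{-N}$ of the columns, so some column separates that fraction of [B]. *)
Lemma separating_column (B : {set {ffun S -> 'I_M}}) :
  (0 < N)%N -> (forall g, g \in B -> injective g) ->
  exists col, (#|[set g in B | ~~ separates col g]| * N ^ N <= #|B| * (N ^ N - 1))%N.
Proof.
move=> N0 injB.
suff [col hcol] : exists col, (#|B| <= #|[set g in B | separates col g]| * N ^ N)%N.
  exists col; rewrite -(cardsID [set g | separates col g] B) in hcol *.
  move: hcol.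
  have -> : [set g in B | separates col g] = B :&: [set g | separates col g].
    by apply/setP => g; rewrite !inE.
  have -> : [set g in B | ~~ separates col g] = B :\: [set g | separates col g].
    by apply/setP => g; rewrite !inE andbC.
  move: #|_| #|_| => x y; have : (0 < N ^ N)%N by rewrite expn_gt0 N0.
  by move: (N ^ N)%N => T T0 h; rewrite mulnBr muln1 leq_subRL ?mulnDl; nia.
apply: contrapT => no.
have lt col : (#|[set g in B | separates col g]| * N ^ N < #|B|)%N.
  by rewrite ltnNge; apply/negP => h; apply: no; exists col.
have Ncol : (0 < #|{: {ffun 'I_M -> S}}|)%N by rewrite card_ffun expn_gt0 N0.
have : (\sum_col #|[set g in B | separates col g]| * N ^ N <
        \sum_(col : {ffun 'I_M -> S}) #|B|)%N.
  have [c0 _] := card_gt0P Ncol.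
  rewrite (bigD1 c0) //= [X in (_ < X)%N](bigD1 c0) //= -addSn leq_add //.
  by apply: leq_sum => c _; exact: ltnW.
rewrite ltnNge => /negP; apply.
rewrite sum_nat_const card_ffun card_ord.
have E col : #|[set g in B | separates col g]| = (\sum_(g in B) separates col g)%N.
  rewrite -sum1_card (eq_bigl (fun g => (g \in B) && separates col g)).
    by rewrite big_mkcondr; apply: eq_bigr => g _; case: separates.
  by move=> g; rewrite inE.
rewrite -big_distrl /=; under eq_bigr do rewrite E.
rewrite exchange_big /= big_distrl /= mulnC -sum_nat_const.
apply: leq_sum => g /injB injg; apply: leq_trans (card_separating injg) _.
rewrite leq_mul2r; apply/orP; right.
rewrite -sum1_card big_mkcond /=; apply: leq_sum => c _.
by rewrite inE; case: separates.
Qed.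

(** A list with [N] or more elements would receive an injection from [S] by enumeration. *)
Lemma small_of_unseparated (L : {set 'I_M}) :
  (forall g, injective g -> ~ (forall s, g s \in L)) -> (#|L| < N)%N.
Proof.
move=> no; rewrite ltnNge; apply/negP => le.
pose g := [ffun s : S => enum_val (widen_ord le (enum_rank s))].
apply: (no g) => [s s'|s]; last by rewrite ffunE; exact: enum_valP.
rewrite !ffunE => /enum_val_inj /(congr1 val) /= h.
by apply: enum_rank_inj; apply: val_inj.
Qed.

End HashColumns.

Lemma exp_gap (t m : nat) : exists k, (t ^ k * m < t.+1 ^ k)%N.
Proof.
have bern k : (t ^ k.+1 + k.+1 * t ^ k <= t.+1 ^ k.+1)%N.
  elim: k => [|k IH]; first by rewrite !expn1 expn0 muln1 addn1.
  rewrite [X in (_ <= X)%N]expnS; apply: leq_trans (leq_mul (leqnn t.+1) IH).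
  rewrite [(t ^ k.+2)%N]expnS [(t ^ k.+1)%N]expnS; move: (t ^ k)%N => y; nia.
(* For this exponent $k=tm+1$ the Bernoulli bound is $t^{k-1}(t+tm+1)$, which exceeds $t^k m$ when
   $t>0$; for $t=0$ the left side vanishes. *)
exists (t * m).+1; apply: leq_trans (bern _).
rewrite expnS; case: t {bern} => [|t]; first by rewrite !mul0n.
have : (0 < t.+1 ^ (t.+1 * m))%N by rewrite expn_gt0.
move: (t.+1 ^ _)%N => y y0; nia.
Qed.

(** * List decoders and their composition over blocks *)

Section Decoders.
Variables (R : realType) (a d : nat) (rho : 'I_a -> 'M[R[i]]_d) (M : nat).
Hypothesis psd_rho : forall i, psdmx (rho i).
Local Notation C := R[i].

(** A measurement in dilated form: outcome [w] leaves the list [cand w], messages off the list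
    produce [w] with amplitude zero, and [Q] records what is guaranteed about the lists. *)
Definition list_decoder n (c : 'I_M -> n.-tuple 'I_a) (Q : {set 'I_M} -> Prop) : Prop :=
  exists (Omega : finType) (V : op R Omega (n.-tuple 'I_d)) (cand : Omega -> {set 'I_M}),
    [/\ is_isometry V,
        forall m w, m \notin cand w -> forall u', \sum_u V w u * prodstate rho (c m) u u' = 0 &
        forall w, Q (cand w)].

Lemma list_decoder_weaken n c (Q Q' : {set 'I_M} -> Prop) :
  (forall L, Q L -> Q' L) -> @list_decoder n c Q -> list_decoder c Q'.
Proof.
by move=> QQ' [Om [V [cand [iV kV qV]]]]; exists Om, V, cand; split=> // w; exact: QQ'.
Qed.

Lemma list_decoder_idle n (c : 'I_M -> n.-tuple 'I_a) :
  list_decoder c (fun L => L = finset.setT).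
Proof.
exists (n.-tuple 'I_d : finType), (@opid R _), (fun=> finset.setT); split=> //.
  rewrite /is_isometry opmul1r; apply: funext => u; apply: funext => v.
  by rewrite /opadj /opid conjc_delta eq_sym.
by move=> m w; rewrite inE.
Qed.

(** Both parts are measured independently. A message must survive both measurements, so the lists
    intersect. *)
Lemma list_decoder_cat n1 n2 c1 c2 (Q1 Q2 : {set 'I_M} -> Prop) :
  @list_decoder n1 c1 Q1 -> @list_decoder n2 c2 Q2 ->
  list_decoder (fun m => cat_tuple (c1 m) (c2 m))
    (fun L => exists L1 L2, [/\ Q1 L1, Q2 L2 & L = L1 :&: L2]).
Proof.
move=> [O1 [V1 [k1 [i1 z1 q1]]]] [O2 [V2 [k2 [i2 z2 q2]]]].
exists (O1 * O2 : finType)%type,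
  (fun w u => V1 w.1 (tuple_left u) * V2 w.2 (tuple_right u)),
  (fun w => k1 w.1 :&: k2 w.2); split.
- apply: funext => u; apply: funext => v; rewrite /opmul /opadj /opid sum_pair /=.
  have e1 := congr1 (fun f => f (tuple_left u) (tuple_left v)) i1.
  have e2 := congr1 (fun f => f (tuple_right u) (tuple_right v)) i2.
  transitivity (opmul (opadj V1) V1 (tuple_left u) (tuple_left v) *
                opmul (opadj V2) V2 (tuple_right u) (tuple_right v)).
    rewrite /opmul mulr_suml; apply: eq_bigr => x _; rewrite mulr_sumr.
    by apply: eq_bigr => y _; rewrite conjcM mulrACA.
  rewrite e1 e2 /opid -natrM mulnb; congr (nat_of_bool _)%:R.
  apply/idP/eqP => [/andP[/eqP E1 /eqP E2]|->]; last by rewrite !eqxx.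
  have [h _ Kb] := cat_tuple_bij 'I_d n1 n2.
  move: E1 E2; rewrite -(Kb u) -(Kb v) /= !tuple_left_cat !tuple_right_cat.
  by move=> -> ->.
- move=> m w mw u'; rewrite big_tuple_cat.
  transitivity ((\sum_u1 V1 w.1 u1 * prodstate rho (c1 m) u1 (tuple_left u')) *
                (\sum_u2 V2 w.2 u2 * prodstate rho (c2 m) u2 (tuple_right u'))).
    rewrite mulr_suml; apply: eq_bigr => u1 _; rewrite mulr_sumr; apply: eq_bigr => u2 _.
    by rewrite prodstate_cat !tuple_left_cat !tuple_right_cat mulrACA.
  move: mw; rewrite inE negb_and => /orP[/z1 ->|/z2 ->]; first by rewrite mul0r.
  by rewrite mulr0.
- by move=> w; exists (k1 w.1), (k2 w.2).
Qed.

Variables (n0 : nat) (t : n0.-tuple 'I_a).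
Hypothesis excl : type_excludable rho t.
Local Notation S := (n0.-tuple 'I_a).

(** Dilation of the excluding POVM: [K s] is a factor of the element for [s], and zero for strings
    of another type, so that every string of length [n0] can serve as a letter. *)
Lemma exclusion_isometry : exists K : S -> op R (n0.-tuple 'I_d) (n0.-tuple 'I_d),
  (forall u v, \sum_s \sum_e conjc (K s e u) * K s e v = (u == v)%:R) /\
  (forall s e u', \sum_u K s e u * prodstate rho s u u' = 0).
Proof.
have [E [pE [sE tE]]] := excl.
have : forall s : S, exists K : op R (n0.-tuple 'I_d) (n0.-tuple 'I_d),
    (forall u v, \sum_e conjc (K e u) * K e v = if same_type s t then E s u v else 0) /\
    (forall e u', \sum_u K e u * prodstate rho s u u' = 0).
  move=> s; case st: (same_type s t); last first.
    by exists (fun _ _ => 0); split=> *; rewrite big1 // => *; rewrite ?conjc0 mul0r.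
  have [K eK] := psd_factor (pE s st); exists K; split=> [u v|]; first by rewrite eK.
  by apply: excluded_kills => //; rewrite -eK tE.
move=> /choice[K hK]; exists K; split=> [u v|s]; last by have [] := hK s.
by rewrite -[RHS]sE [RHS]big_mkcond; apply: eq_bigr => s _; have [-> _] := hK s.
Qed.

Lemma list_decoder_block (col : {ffun 'I_M -> S}) :
  list_decoder col (fun L => exists z, L = [set m | col m != z]).
Proof.
have [K [sK kK]] := exclusion_isometry.
exists (S * n0.-tuple 'I_d : finType)%type, (fun w u => K w.1 w.2 u),
  (fun w => [set m | col m != w.1]); split.
- apply: funext => u; apply: funext => v.
  by rewrite /opmul /opadj /opid sum_pair -sK.
- by move=> m w; rewrite inE negbK => /eqP -> u'; exact: kK.
- by move=> w; exists w.1.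
Qed.

Local Notation N := #|{: S}|.

(** Greedy construction: [B] holds the injections that no column chosen so far separates, starting
    from at most $M^N$ and shrinking by the factor $1-N^{-N}$ with every further block. *)
Lemma list_decoder_blocks (a_gt0 : (0 < a)%N) q :
  exists (c : 'I_M -> (q * n0).-tuple 'I_a) (B : {set {ffun S -> 'I_M}}),
    [/\ forall g, g \in B -> injective g,
        (#|B| * (N ^ N) ^ q <= M ^ N * (N ^ N - 1) ^ q)%N &
        list_decoder c (fun L => forall g : {ffun S -> 'I_M}, injective g -> (forall s, g s \in L) -> g \in B)].
Proof.
elim: q => [|q [c [B [injB cardB dec]]]].
  exists (fun=> [tuple]), [set g : {ffun S -> 'I_M} | injectiveb g]; split.
  - by move=> g; rewrite inE => /injectiveP.
  - have -> : (M ^ N = #|{: {ffun S -> 'I_M}}|)%N by rewrite card_ffun card_ord.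
    by rewrite !expn0 !muln1; exact: max_card.
  - apply: list_decoder_weaken (list_decoder_idle _) => L _ g injg _.
    by rewrite inE; exact/injectiveP.
have N0 : (0 < N)%N by rewrite card_tuple card_ord expn_gt0 a_gt0.
have [col hcol] := separating_column N0 injB.
exists (fun m => cat_tuple (col m) (c m)), [set g in B | ~~ separates col g]; split.
- by move=> g; rewrite inE => /andP[/injB].
- rewrite !expnS mulnA.
  apply: leq_trans (leq_mul hcol (leqnn _)) _.
  by rewrite mulnAC [X in (X <= _)%N]mulnC [X in (_ <= X)%N]mulnCA leq_mul2l cardB orbT.
- apply: list_decoder_weaken (list_decoder_cat (list_decoder_block col) dec).
  (* If the new column separated [g], the message [g z] would carry the letter [z] in this block and
     be ruled out by the outcome [z]. *)
  move=> L [L1 [L2 [[z ->] h2 ->]]] g injg gL; rewrite inE h2 //=.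
    by apply/negP => /forallP/(_ z)/eqP E; have := gL z; rewrite !inE E eqxx.
  by move=> s; have := gL s; rewrite inE => /andP[].
Qed.

End Decoders.

(** * Zero-error codes from list decoders *)

Section Codes.
Variables (R : realType) (a d : nat) (rho : 'I_a -> 'M[R[i]]_d).
Local Notation C := R[i].

(** Of the [k.+1] bits, one is idle while Bob measures and the other [k] resolve the list. The
    initial state is one-dimensional, so no entanglement is used. *)
Lemma list_decoder_code M n k (c : 'I_M -> n.-tuple 'I_a) :
  list_decoder rho c (fun L => #|L| <= k.+1)%N ->
  exists c : @fcode R a d rho n k.+1 M, zero_error c.
Proof.
move=> [Omega [V [cand [isoV kill small]]]].
have win := @wins_letters R a d rho M k Omega cand small n unit (fun _ _ _ => 1) c
  (fun w p => V w p.2).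
have card1 : #|{: unit}| = 1%N by exact: card_unit.
apply: (winning_code (l := nseq n true ++ false :: nseq k false)
  (x := #|{: unit}|) (f := #|{: unit}|) (y := #|{: unit}|) (phi := fun=> 1)) => //.
- under eq_bigr do rewrite conjc1 mulr1.
  by rewrite sumr_const !card_prod !card_ord card1.
- by rewrite size_cat /= !size_nseq.
- by rewrite count_cat /= !count_nseq /= mul1n mul0n !addn0.
have {}win : wins rho (nseq n true ++ false :: nseq k false)
    (fun (m : 'I_M) (p q : unit * unit * unit) => 1).
  apply: win.
    apply: funext => -[[] u]; apply: funext => -[[] v].
    have := congr1 (fun f => f u v) isoV.
    by rewrite /opmul /opadj /opid xpair_eqE eqxx.
  move=> m w mw y' u'; rewrite -[RHS](kill m w mw u') sum_pair (big_pred1 tt) //.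
  by apply: eq_bigr => u _; rewrite mul1r.
move: win; rewrite /wins; congr winning.
by apply: funext => m; apply: funext => p; apply: funext => q; rewrite /to_ord conjc1 mulr1.
Qed.

Lemma exponentially_many_messages n0 (t : n0.-tuple 'I_a) :
  (0 < a)%N -> (forall i, psdmx (rho i)) -> type_excludable rho t ->
  exists b K, forall j n, (0 < j)%N -> (K * j <= n)%N ->
    exists c : @fcode R a d rho n b (2 ^ j), zero_error c.
Proof.
move=> a_gt0 psd_rho excl.
pose N := #|{: n0.-tuple 'I_a}|.
have N0 : (0 < N)%N by rewrite /N card_tuple card_ord expn_gt0 a_gt0.
(* [k] is the number of blocks spent per message bit: $(N^N-1)^k\,2^N<(N^N)^k$. *)
have [k gap] := exp_gap (N ^ N - 1) (2 ^ N).
have T0 : (0 < N ^ N)%N by rewrite expn_gt0 N0.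
rewrite subn1 prednK // -subn1 in gap.
exists N.+1, (k * n0)%N => j n j0 Kn.
have [c [B [injB cardB dec]]] := @list_decoder_blocks R a d rho (2 ^ j) psd_rho n0 t excl a_gt0 (k * j).
(* With $M=2^j$ and $kj$ blocks the size bound reads $|B|\,(N^N)^{kj}\le
   (2^N(N^N-1)^k)^j<(N^N)^{kj}$, so no unseparated injection is left. *)
have B0 : #|B| = 0%N.
  apply/eqP; rewrite eqn0Ngt; apply/negP => B0.
  have : ((N ^ N) ^ (k * j) <= #|B| * (N ^ N) ^ (k * j))%N by rewrite leq_pmull.
  move=> /leq_trans /(_ cardB); rewrite leqNgt => /negP; apply.
  rewrite !expnM -expnM mulnC [(j * _)%N]mulnC expnM -expnMn.
  by rewrite ltn_exp2r.
have le : (k * j * n0 <= n)%N by rewrite mulnAC.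
rewrite -(subnKC le).
have i0 : 'I_a := Ordinal a_gt0.
(* The channel uses beyond the blocks are padded with a fixed letter and ignored by the decoder. *)
apply: (@list_decoder_code _ _ _ (fun m => cat_tuple (c m) (nseq_tuple _ i0))).
apply: list_decoder_weaken (list_decoder_cat dec (list_decoder_idle _ _)).
move=> L [L1 [L2 [h _ ->]]]; apply: (@leq_trans #|L1|).
  by apply: subset_leq_card; exact: finset.subsetIl.
apply: leq_trans (leqnSn _); apply: ltnW; apply: small_of_unseparated => g injg gL.
by have := h g injg gL; rewrite (cards0_eq B0) inE.
Qed.

End Codes.

(** * From numbers of messages to the capacity *)

Section Rates.
Local Open Scope classical_set_scope.
Variables (R : realType) (a d : nat) (rho : 'I_a -> 'M[R[i]]_d).

Lemma einfs_le_limn (u : nat -> \bar R) n : (einfs u n <= limn_einf u)%E.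
Proof.
rewrite limn_einf_lim (cvg_lim _ (@cvg_einfs_sup _ u)) //.
by apply: ereal_sup_ubound; exists n.
Qed.

Lemma limn_einf_le (u : nat -> \bar R) x : (forall n, einfs u n <= x)%E -> (limn_einf u <= x)%E.
Proof.
move=> h; rewrite limn_einf_lim (cvg_lim _ (@cvg_einfs_sup _ u)) //.
by apply: ge_ereal_sup => _ [n _ <-].
Qed.

Lemma rate_ge b n j : (exists c : @fcode R a d rho n b (2 ^ j), zero_error c) ->
  ((j%:R / n%:R)%:E <= rate rho b n)%E.
Proof.
move=> [c zc].
have : (((2 ^ j)%N%:R)%:E <= Mf rho b n)%E.
  by apply: ereal_sup_ubound; exists (2 ^ j)%N => //; exists c.
rewrite /rate; case: (Mf rho b n) => [x| |]; rewrite ?leey // lee_fin => le.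
rewrite lee_fin ler_wpM2r ?invr_ge0 ?ler0n //.
have ln2 : 0 < ln (2 : R) by rewrite ln_gt0 // ltr1n.
rewrite ler_pdivlMr // mulr_natl -lnXn //.
have p2 : 0 < (2 : R) ^+ j by rewrite exprn_gt0.
rewrite natrX in le.
by rewrite ler_ln // posrE; exact: lt_le_trans le.
Qed.

Lemma C0EF_act_gt0 b K :
  (forall j n, (0 < j)%N -> (K * j <= n)%N ->
     exists c : @fcode R a d rho n b (2 ^ j), zero_error c) ->
  (0 < C0EF_act rho)%E.
Proof.
move=> codes; pose K' := K.+1.
(* For $n\ge K'$ the rate is at least $\lfloor n/K'\rfloor/n\ge 1/(2K')$; taking $K'=K+1$ keeps the
   divisor positive. *)
apply: (@lt_le_trans _ _ ((2 * K'%:R)^-1)%:E).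
  by rewrite lte_fin invr_gt0 mulr_gt0 // ltr0n.
apply: (@le_trans _ _ (limn_einf (rate rho b))); last by apply: ereal_sup_ubound; exists b.
apply: le_trans (einfs_le_limn _ K').
apply: le_ereal_inf_tmp => _ [n /= Kn <-].
have n0 : (0 < n)%N by exact: leq_trans Kn.
have j0 : (0 < n %/ K')%N by rewrite divn_gt0.
have := @rate_ge b n (n %/ K'); move=> /(_ (codes _ _ j0 _)) h.
apply: (le_trans _ (h _)); last first.
  by apply: leq_trans (leq_trunc_div n K'); rewrite mulnC leq_mul2l leqnSn orbT.
rewrite lee_fin -[X in X <= _]mul1r ler_pdivrMr; last by rewrite mulr_gt0 // ltr0n.
rewrite mulrAC ler_pdivlMr ?ltr0n // mul1r -!natrM ler_nat.
have := divn_eq n K'; have := ltn_pmod n (ltn0Sn K); rewrite -/K' => h1 h2.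
by move: h1 h2 j0; move: (n %/ K')%N (n %% K')%N => q r; nia.
Qed.

(** A bound on the messages that does not grow with [n] makes the rate at most $b/n$, whose limit is
    zero for each fixed [b]. *)
Lemma C0EF_act_le0 :
  (forall b n M, (exists c : @fcode R a d rho n b M, zero_error c) -> (M <= 2 ^ b)%N) ->
  (C0EF_act rho <= 0)%E.
Proof.
move=> bound; apply: ge_ereal_sup => _ [b _ <-].
apply: limn_einf_le => n; apply/lee_addgt0Pr => e e0; rewrite add0e.
have [k hk] : exists k, b%:R / e < k%:R.
  by exists (Num.Def.archi_bound (b%:R / e)); apply: archi_boundP; rewrite divr_ge0 // ltW.
(* A position in the tail starting at [n] where $b/m<e$; the infimum of the tail is at most the term
   there. *)
pose m := (n + k.+1)%N.
apply: (@le_trans _ _ (rate rho b m)).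
  by apply: ereal_inf_lbound; exists m => //=; rewrite leq_addr.
have Mle : (Mf rho b m <= ((2 ^+ b : R))%:E)%E.
  apply: ge_ereal_sup => _ [M /= hM <-]; rewrite lee_fin -natrX ler_nat.
  exact: bound hM.
rewrite /rate; case: (Mf rho b m) Mle => [x| |]; rewrite ?leye_eq ?leNye // !lee_fin => xb.
have ln2 : 0 < ln (2 : R) by rewrite ln_gt0 // ltr1n.
have m0 : 0 < m%:R :> R by rewrite ltr0n /m addnS.
apply: (@le_trans _ _ (b%:R / m%:R)).
  rewrite ler_wpM2r ?invr_ge0 ?ler0n // ler_pdivrMr // mulr_natl -lnXn //.
  (* For nonpositive arguments [ln] has the default value 0, which satisfies the bound too. *)
  have [x0|x0] := ltP 0 x.
    by rewrite ler_ln // posrE exprn_gt0.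
  by rewrite ln0 // ln_ge0 // -natrX ler1n expn_gt0.
rewrite ler_pdivrMr // mulrC -ler_pdivrMr //.
by apply: (le_trans (ltW hk)); rewrite ler_nat /m addnS -addSn leq_addl.
Qed.

End Rates.

(** * Supports with trivial intersection *)

Section InnerProduct.
Variable R : realType.
Local Notation C := R[i].

Lemma adjmxM m n p (A : 'M[C]_(m, n)) (B : 'M[C]_(n, p)) :
  adjmx (A *m B) = adjmx B *m adjmx A.
Proof. by rewrite /adjmx map_mxM trmx_mul. Qed.

Lemma adjmxK m n (A : 'M[C]_(m, n)) : adjmx (adjmx A) = A.
Proof. by apply/matrixP => i j; rewrite /adjmx !mxE conjcK. Qed.

Lemma cdotDr n (u v w : 'cV[C]_n) : cdot u (v + w) = cdot u v + cdot u w.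
Proof. by rewrite /cdot mulmxDr mxE. Qed.

Lemma cdotZr n (c : C) (u v : 'cV[C]_n) : cdot u (c *: v) = c * cdot u v.
Proof. by rewrite /cdot -scalemxAr mxE. Qed.

Lemma cdotNr n (u v : 'cV[C]_n) : cdot u (- v) = - cdot u v.
Proof. by rewrite /cdot mulmxN mxE. Qed.

Lemma cdotBr n (u v w : 'cV[C]_n) : cdot u (v - w) = cdot u v - cdot u w.
Proof. by rewrite cdotDr cdotNr. Qed.

Lemma cdot_sumr n (I : Type) (r : seq I) (Q : pred I) (u : 'cV[C]_n) (F : I -> 'cV[C]_n) :
  cdot u (\sum_(i <- r | Q i) F i) = \sum_(i <- r | Q i) cdot u (F i).
Proof. by rewrite /cdot mulmx_sumr summxE. Qed.

Lemma conjc_cdot n (u v : 'cV[C]_n) : conjc (cdot u v) = cdot v u.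
Proof. by rewrite !cdotE conjc_sum; apply: eq_bigr => i _; rewrite conjcM conjcK mulrC. Qed.

Lemma cdot_adj m n (A : 'M[C]_(m, n)) (u : 'cV[C]_n) (v : 'cV[C]_m) :
  cdot (A *m u) v = cdot u (adjmx A *m v).
Proof. by rewrite /cdot adjmxM mulmxA. Qed.

Lemma cdotZl n (c : C) (u v : 'cV[C]_n) : cdot (c *: u) v = conjc c * cdot u v.
Proof. by rewrite -conjc_cdot cdotZr conjcM conjc_cdot. Qed.

Lemma cdotBl n (u v w : 'cV[C]_n) : cdot (u - v) w = cdot u w - cdot v w.
Proof. by rewrite -conjc_cdot cdotBr rmorphB /= !conjc_cdot. Qed.

Lemma cdot_ge0 n (v : 'cV[C]_n) : 0 <= cdot v v.
Proof. by rewrite cdotE; apply: sumr_ge0 => i _; exact: conjM_ge0. Qed.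

Lemma cdot_eq0 n (v : 'cV[C]_n) : cdot v v = 0 -> v = 0.
Proof.
move/eqP; rewrite cdotE psumr_eq0 => [/allP h|i _]; last exact: conjM_ge0.
apply/matrixP => i j; rewrite (ord1 j) mxE.
have := h i (mem_index_enum _).
by rewrite /= mulf_eq0 conjc_eq0 orbb => /eqP.
Qed.

Lemma cdot_real n (v : 'cV[C]_n) : real_complex R (complex.Re (cdot v v)) = cdot v v.
Proof. by apply: RRe_real; exact: ger0_real (cdot_ge0 v). Qed.

Lemma vnorm_le n (v : 'cV[C]_n) (c : R) : 0 <= c ->
  (vnorm v <= c) = (cdot v v <= real_complex R (c ^+ 2)).
Proof.
move=> c0; rewrite -cdot_real lecR /vnorm -[X in (_ <= X) = _](ger0_norm c0) -sqrtr_sqr.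
by rewrite ler_sqrt ?sqr_ge0.
Qed.

Lemma vnorm1P n (v : 'cV[C]_n) : (vnorm v = 1) <-> (cdot v v = 1).
Proof.
rewrite -cdot_real /vnorm; split=> [h|[h]].
  have h0 : 0 <= complex.Re (cdot v v) by have := cdot_ge0 v; rewrite -cdot_real ler0c.
  by rewrite -(sqr_sqrtr h0) h expr1n.
by rewrite h sqrtr1.
Qed.

Lemma exists_unit_scale n (v : 'cV[C]_n) : v != 0 ->
  exists c : C, cdot (c *: v) (c *: v) = 1.
Proof.
move=> v0; have nz : cdot v v != 0 by apply: contra_neq v0; exact: cdot_eq0.
have p : 0 < cdot v v by rewrite lt_def nz cdot_ge0.
have s0 : sqrtc (cdot v v) != 0 by rewrite sqrtc_eq0.
have sr : conjc (sqrtc (cdot v v)) = sqrtc (cdot v v).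
  have := cdot_ge0 v; rewrite -sqrtc_ge0; case: (sqrtc _) => x y.
  by rewrite lecE /= => /andP[/eqP -> _]; rewrite oppr0.
exists (sqrtc (cdot v v))^-1.
rewrite cdotZl cdotZr conjc_inv sr mulrA -{3}(sqr_sqrtc (cdot v v)) expr2.
by field.
Qed.

Section Projector.
Variables (n : nat) (P : 'M[C]_n).
Hypotheses (PP : P *m P = P) (Ph : adjmx P = P).

Lemma cdot_proj u v : cdot u (P *m v) = cdot (P *m u) (P *m v).
Proof. by rewrite cdot_adj Ph mulmxA PP. Qed.

Lemma cdot_proj_split v :
  cdot v v = cdot (P *m v) (P *m v) + cdot (v - P *m v) (v - P *m v).
Proof.
by rewrite cdotBl !cdotBr [cdot (P *m v) v]cdot_adj Ph !(cdot_proj v v); ring.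
Qed.

Lemma cdot_proj_le v : cdot (P *m v) (P *m v) <= cdot v v.
Proof. by rewrite [X in _ <= X]cdot_proj_split lerDl cdot_ge0. Qed.

Lemma cdot_proj_fix v : cdot (P *m v) (P *m v) = cdot v v -> P *m v = v.
Proof.
move=> E; have := cdot_proj_split v; rewrite E => /eqP.
rewrite -{1}[cdot v v]addr0 (inj_eq (addrI _)) eq_sym => /eqP/cdot_eq0/subr0_eq.
by move=> <-.
Qed.

End Projector.

(** An eigenvalue of $\sum_iP_i$ at a unit eigenvector [v] is $\sum_i\|P_iv\|^2\le a$, and equality
    would put [v] into every range. Finitely many eigenvalues leave a gap [c] below [a], which
    bounds both the form and the norm. *)
Lemma proj_sum_gap a d (P : 'I_a -> 'M[C]_d) :
  (0 < a)%N -> (forall i, P i *m P i = P i) -> (forall i, adjmx (P i) = P i) ->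
  (forall v : 'cV[C]_d, (forall i, P i *m v = v) -> v = 0) ->
  exists c : R, [/\ 0 < c, c < a%:R,
    forall v : 'cV[C]_d, cdot v ((\sum_i P i) *m v) <= real_complex R c * cdot v v &
    forall v : 'cV[C]_d, cdot ((\sum_i P i) *m v) ((\sum_i P i) *m v)
      <= real_complex R (c ^+ 2) * cdot v v].
Proof.
move=> a0 PP Ph cap; pose A := \sum_i P i.
have formA v : cdot v (A *m v) = \sum_i cdot (P i *m v) (P i *m v).
  by rewrite mulmx_suml cdot_sumr; apply: eq_bigr => i _; rewrite cdot_proj.
have /psdmx_op/psd_spectral[U [D [U1 U2 D0 eA]]] : psdmx A.
  by move=> v; rewrite formA; apply: sumr_ge0 => i _; exact: cdot_ge0.
have UU k l : \sum_i U k i * conjc (U l i) = (k == l)%:R.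
  by have := congr1 (fun f => f k l) U2; rewrite /opmul /opadj.
(* Coordinates in the eigenbasis, where the inner product is preserved and $\sum_iP_i$ acts
   diagonally. *)
pose x (v : 'cV[C]_d) k := \sum_i U k i * v i 0.
have parseval u v : cdot u v = \sum_k conjc (x u k) * x v k.
  rewrite cdotE; under [RHS]eq_bigr do rewrite conjc_sum mulr_suml.
  rewrite [RHS]exchange_big; apply: eq_bigr => i _.
  under [RHS]eq_bigr do rewrite mulr_sumr.
  rewrite [RHS]exchange_big /=.
  transitivity (\sum_j (i == j)%:R * (conjc (u i 0) * v j 0)); first by rewrite sum_delta.
  apply: eq_bigr => j _.
  have <- : opmul (opadj U) U i j = (i == j)%:R by rewrite U1.
  by rewrite /opmul mulr_suml; apply: eq_bigr => k _; rewrite /opadj conjcM; ring.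
have xA v k : x (A *m v) k = D k * x v k.
  rewrite /x; under eq_bigr do rewrite mxE mulr_sumr.
  rewrite exchange_big mulr_sumr; apply: eq_bigr => j _.
  under eq_bigr do rewrite mulrA.
  rewrite -mulr_suml mulrA; congr (_ * _).
  under eq_bigr do rewrite eA mulr_sumr.
  rewrite exchange_big /=.
  transitivity (\sum_l (k == l)%:R * (D l * U l j)); last by rewrite sum_delta.
  by apply: eq_bigr => l _; rewrite -UU mulr_suml; apply: eq_bigr => i _; ring.
have Dlt k : D k < a%:R.
  pose v : 'cV[C]_d := \col_i conjc (U k i).
  have xv l : x v l = (k == l)%:R.
    by rewrite eq_sym -UU; apply: eq_bigr => i _; rewrite mxE.
  have nv : cdot v v = 1.
    rewrite parseval; under eq_bigr do rewrite !xv conjc_delta.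
    by rewrite sum_delta eqxx.
  have -> : D k = cdot v (A *m v).
    rewrite parseval; under eq_bigr do rewrite xA !xv conjc_delta.
    by rewrite sum_delta eqxx mulr1.
  rewrite formA lt_neqAle; apply/andP; split; last first.
    have -> : a%:R = \sum_(i < a) (1 : C) by rewrite sumr_const card_ord.
    by apply: ler_sum => i _; rewrite -nv; exact: cdot_proj_le.
  apply/eqP => E; have /cap v0 : forall i, P i *m v = v.
    have : \sum_(i < a) (cdot v v - cdot (P i *m v) (P i *m v)) == 0.
      by rewrite sumrB E nv sumr_const card_ord subrr.
    rewrite psumr_eq0 => [/allP h i|i _]; last by rewrite subr_ge0 cdot_proj_le.
    apply: cdot_proj_fix => //; apply/esym/eqP; rewrite -subr_eq0.
    exact: h (mem_index_enum _).
  by move: nv; rewrite v0 /cdot mulmx0 mxE => /esym/eqP; rewrite oner_eq0.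
have Dr k : real_complex R (complex.Re (D k)) = D k by apply: RRe_real; exact: ger0_real (D0 k).
(* The initial value $a/2$ keeps [c] positive even when all eigenvalues vanish or the space has
   dimension zero. *)
pose c := \big[Num.max/(a%:R / 2)]_k complex.Re (D k).
have ar : 0 < (a%:R : R) by rewrite ltr0n.
have cD k : complex.Re (D k) <= c by exact: le_bigmax.
have c0 : 0 < c by apply: lt_le_trans (bigmax_ge_id _ _ _ _); rewrite divr_gt0.
have cDC k : D k <= real_complex R c by rewrite -Dr lecR.
exists c; split=> //.
- apply: bigmax_lt => [|k _]; first by rewrite ltr_pdivrMr // ltr_pMr // ltr1n.
  by have := Dlt k; rewrite -Dr -(rmorph_nat (real_complex R)) ltcR.
- move=> v; rewrite !parseval mulr_sumr; apply: ler_sum => k _.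
  by rewrite xA mulrCA ler_wpM2r ?conjM_ge0.
- move=> v; rewrite !parseval mulr_sumr; apply: ler_sum => k _.
  rewrite xA conjcM mulrACA ler_wpM2r ?conjM_ge0 // rmorphXn expr2 /=.
  have -> : conjc (D k) = D k by rewrite -Dr conjc_real.
  by rewrite ler_pM.
Qed.

End InnerProduct.

(** * Exclusion by a perturbation of the identity *)

Section NeumannInversion.
Variables (R : realType) (D : nat) (I : finType) (S : {set I}) (P : I -> 'M[R[i]]_D).
Local Notation C := R[i].
Local Notation "c %:C" := (real_complex R c).
Hypotheses (S0 : (0 < #|S|)%N) (PP : forall s, P s *m P s = P s)
  (Ph : forall s, adjmx (P s) = P s).
Hypothesis small : forall v : 'cV[C]_D,
  \sum_(s in S) cdot (P s *m v) (P s *m v) <= (12%:R)^-1 * #|S|%:R * cdot v v.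
Let Q s := 1%:M - P s.

Definition compress_avg (X : 'M[C]_D) : 'M[C]_D := (#|S|%:R)^-1 *: \sum_(s in S) Q s *m X *m Q s.

Lemma compress_avg_linear : linear compress_avg.
Proof.
move=> k X Y; rewrite /compress_avg [k *: (_ *: _)]scalerA mulrC -scalerA -scalerDr.
congr (_ *: _); rewrite scaler_sumr -big_split /=; apply: eq_bigr => s _.
by move: (Q s) => q; rewrite mulmxDr mulmxDl -scalemxAr -scalemxAl.
Qed.

HB.instance Definition _ :=
  GRing.isLinear.Build C 'M[C]_D 'M[C]_D _ compress_avg compress_avg_linear.

(* For real [c] this says that the operator norm of [X] is at most [c]. *)
Definition norm_le (X : 'M[C]_D) (c : R) : Prop := forall u v : 'cV[C]_D,
  cdot u (X *m v) + cdot (X *m v) u <= c%:C * (cdot u u + cdot v v).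

Lemma cdotNl (u v : 'cV[C]_D) : cdot (- u) v = - cdot u v.
Proof. by rewrite -scaleN1r cdotZl rmorphN rmorph1 mulN1r. Qed.

Lemma ltc0R (c : R) : (0 < c%:C) = (0 < c).
Proof. exact: (ltcR 0 c). Qed.

(** This is $\|cu-v\|^2\ge0$ divided by $c$. *)
Lemma amgm (u v : 'cV[C]_D) (c : R) : 0 < c ->
  cdot u v + cdot v u <= c%:C * cdot u u + (c^-1)%:C * cdot v v.
Proof.
move=> c0; have c0' : 0 < c%:C by rewrite ltc0R.
have := cdot_ge0 (c%:C *: u - v).
rewrite cdotBl !cdotBr !cdotZl !cdotZr conjc_real => h.
rewrite -(ler_pM2l c0') -subr_ge0; apply: le_trans h _.
rewrite fmorphV le_eqVlt; apply/orP; left; apply/eqP.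
by field; rewrite gt_eqF.
Qed.

Lemma norm_leD X Y b c : norm_le X b -> norm_le Y c -> norm_le (X + Y) (b + c).
Proof.
move=> hX hY u v; rewrite mulmxDl cdotDr -[cdot (_ + _) u]conjc_cdot cdotDr conjcD !conjc_cdot.
by rewrite rmorphD /= mulrDl addrACA lerD.
Qed.

Lemma norm_le_weaken X b c : b <= c -> norm_le X b -> norm_le X c.
Proof.
move=> bc h u v; apply: le_trans (h u v) _.
by rewrite ler_wpM2r ?addr_ge0 ?cdot_ge0 // lecR.
Qed.

Lemma norm_le_adj X c : norm_le X c -> norm_le (adjmx X) c.
Proof.
move=> h u v; rewrite -cdot_adj [cdot (adjmx X *m v) u]cdot_adj adjmxK.
by rewrite addrC [X in _ * X]addrC.
Qed.

(** The defining inequality is tested at $u=c^{-1}Xv$. *)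
Lemma norm_le_sqr X c (v : 'cV[C]_D) : 0 < c -> norm_le X c ->
  (c^-1)%:C * cdot (X *m v) (X *m v) <= c%:C * cdot v v.
Proof.
move=> c0 h; have := h ((c^-1)%:C *: (X *m v)) v.
rewrite !cdotZl !cdotZr !conjc_real.
set w := cdot (X *m v) _.
have c1 : c%:C * (c^-1)%:C = 1 by rewrite -rmorphM /= divff ?gt_eqF.
by rewrite mulrDr !mulrA c1 mul1r lerD2l.
Qed.

(** A crude entrywise bound. Its shape $2+k$ prepares the descent on [k] in [fixpoint_norm_le]. *)
Lemma norm_le_exists X : exists k : nat, norm_le X (2 + k%:R).
Proof.
pose c := \sum_i \sum_j (1 + complex.Re (conjc (X i j) * X i j)).
have cX i j : (complex.Re (conjc (X i j) * X i j))%:C = conjc (X i j) * X i j.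
  by apply: RRe_real; exact: ger0_real (conjM_ge0 _).
have Xc : norm_le X c.
  move=> u v; have coord (w : 'cV[C]_D) j : conjc (w j 0) * w j 0 <= cdot w w.
    by rewrite cdotE (bigD1 j) //= lerDl sumr_ge0 // => *; exact: conjM_ge0.
  have -> : cdot u (X *m v) = \sum_i \sum_j conjc (u i 0) * (X i j * v j 0).
    by rewrite cdotE; apply: eq_bigr => i _; rewrite mxE mulr_sumr.
  have -> : cdot (X *m v) u = \sum_i \sum_j conjc (X i j * v j 0) * u i 0.
    by rewrite cdotE; apply: eq_bigr => i _; rewrite mxE conjc_sum mulr_suml.
  rewrite /c rmorph_sum mulr_suml -big_split; apply: ler_sum => i _ /=.
  rewrite rmorph_sum mulr_suml -big_split; apply: ler_sum => j _ /=.
  rewrite rmorphD rmorph1 /= cX.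
  have h : conjc (u i 0) * (X i j * v j 0) + conjc (X i j * v j 0) * u i 0 <=
      conjc (u i 0) * u i 0 + conjc (X i j * v j 0) * (X i j * v j 0).
    rewrite -subr_ge0; apply: le_trans (conjM_ge0 (u i 0 - X i j * v j 0)) _.
    by rewrite rmorphB /= le_eqVlt; apply/orP; left; apply/eqP; ring.
  apply: le_trans h _; rewrite mulrDl mul1r mulrDr.
  apply: lerD; first by apply: le_trans (coord u i) _; rewrite lerDl cdot_ge0.
  apply: le_trans (_ : conjc (X i j) * X i j * cdot v v <= _).
    by rewrite conjcM mulrACA ler_wpM2l ?conjM_ge0.
  by rewrite lerDr mulr_ge0 ?conjM_ge0 ?cdot_ge0.
exists (Num.Def.archi_bound c); apply: norm_le_weaken Xc.
have c0 : 0 <= c.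
  apply: sumr_ge0 => i _; apply: sumr_ge0 => j _; rewrite addr_ge0 //.
  by rewrite -ler0c cX conjM_ge0.
by apply: (le_trans (ltW (archi_boundP c0))); rewrite lerDr.
Qed.

(** From $X-QXQ=PX+XP-PXP$: the first two terms are split by [amgm], the third is estimated by the
    bound on [X], and each of the three averages to at most $c/12$. *)
Lemma compress_avg_dist X c : 0 < c -> norm_le X c -> norm_le (X - compress_avg X) (c / 4).
Proof.
move=> c0 hX u v.
have n0 : (#|S|%:R : C) != 0 by rewrite pnatr_eq0 -lt0n.
have np : 0 < (#|S|%:R : C) by rewrite ltr0n.
pose Z s := X - Q s *m X *m Q s.
have -> : X - compress_avg X = (#|S|%:R)^-1 *: \sum_(s in S) Z s.
  rewrite sumrB scalerBr sumr_const -[X *+ _]scaler_nat scalerA mulVf // scale1r.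
  by [].
rewrite -scalemxAl cdotZr cdotZl conjc_inv conjc_nat -mulrDr ler_pdivrMl //.
rewrite mulmx_suml cdot_sumr -[cdot (\sum_(s in S) _) u]conjc_cdot cdot_sumr conjc_sum -big_split /=.
pose F s := c%:C * cdot (P s *m u) (P s *m u)
   + (c^-1)%:C * cdot (P s *m (X *m v)) (P s *m (X *m v))
   + (c%:C * cdot (P s *m v) (P s *m v)
   + (c^-1)%:C * cdot (P s *m (adjmx X *m u)) (P s *m (adjmx X *m u)))
   + (c%:C * cdot (P s *m u) (P s *m u) + c%:C * cdot (P s *m v) (P s *m v)).
apply: (@le_trans _ _ (\sum_(s in S) F s)).
  apply: ler_sum => s _; rewrite conjc_cdot.
  have -> : Z s *m v = P s *m (X *m v) + X *m (P s *m v) - P s *m (X *m (P s *m v)).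
    have Qw w : Q s *m w = w - P s *m w by rewrite mulmxBl mul1mx.
    rewrite /Z mulmxBl -!mulmxA !Qw !mulmxBr.
    move: (X *m v) (X *m _) (P s *m _) (P s *m _) => x y z t.
    by apply/colP => i; rewrite !mxE; ring.
  rewrite -[cdot (_ - _) u]conjc_cdot !cdotBr !cdotDr rmorphB rmorphD /= !conjc_cdot.
  have h1 := amgm (P s *m u) (P s *m (X *m v)) c0.
  have h2 := amgm (P s *m v) (P s *m (adjmx X *m u)) c0.
  have h3 := hX (- (P s *m u)) (P s *m v).
  have e1 z : cdot u (P s *m z) = cdot (P s *m u) z by rewrite cdot_adj Ph.
  have e2 z : cdot u (X *m z) = cdot (adjmx X *m u) z by rewrite cdot_adj adjmxK.
  have f1 z : cdot (P s *m z) u = cdot z (P s *m u) by rewrite cdot_adj Ph.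
  have f2 z : cdot (X *m z) u = cdot z (adjmx X *m u) by rewrite cdot_adj.
  have g w z : cdot (P s *m w) (P s *m z) = cdot (P s *m w) z.
    by rewrite [RHS]cdot_adj Ph -(cdot_proj (PP s) (Ph s)).
  have g' w z : cdot (P s *m w) (P s *m z) = cdot w (P s *m z).
    by rewrite -(cdot_proj (PP s) (Ph s)).
  rewrite g (g' (X *m v)) in h1; rewrite g (g' (adjmx X *m u)) addrC in h2.
  rewrite !cdotNl !cdotNr opprK mulrDr in h3.
  rewrite !(e1, e2, f1, f2) addrACA [X in X + _ <= _]addrACA.
  exact: lerD (lerD h1 h2) h3.
rewrite /F !big_split /= -!mulr_sumr.
have bnd (w : 'cV[C]_D) (k : R) : 0 <= k ->
    k%:C * \sum_(s in S) cdot (P s *m w) (P s *m w) <=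
    (12%:R)^-1 * #|S|%:R * (k%:C * cdot w w).
  by move=> k0; rewrite mulrCA ler_wpM2l ?ler0c.
have c1 : 0 <= c by exact: ltW.
have c2 : 0 <= c^-1 by rewrite invr_ge0.
have b1 := bnd u c c1; have b2 := bnd (X *m v) _ c2.
have b3 := bnd (adjmx X *m u) _ c2; have b4 := bnd v c c1.
have e0 : 0 <= (12%:R)^-1 * #|S|%:R :> C by rewrite mulr_ge0 ?invr_ge0 ?ler0n.
have {}b2 := le_trans b2 (ler_wpM2l e0 (norm_le_sqr v c0 hX)).
have {}b3 := le_trans b3 (ler_wpM2l e0 (norm_le_sqr u c0 (norm_le_adj hX))).
have := lerD (lerD (lerD b1 b2) (lerD b4 b3)) (lerD b1 b4).
move=> h; apply: le_trans h _.
have -> : (c / 4)%:C = c%:C / 4%:R by rewrite rmorphM fmorphV rmorph_nat.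
by rewrite le_eqVlt; apply/orP; left; apply/eqP;
  field.
Qed.

Lemma norm_le1 : norm_le 1%:M 1.
Proof.
move=> u v; rewrite !mul1mx mul1r; have := amgm u v (ltr01 : 0 < 1).
by rewrite invr1 !mul1r.
Qed.

(** A bound $2+(k+1)$ improves to $1+(3+k)/4\le 2+k$, so any initial bound descends to 2. This
    replaces summing the Neumann series. *)
Lemma fixpoint_norm_le X E : norm_le E 1 -> X = E + (X - compress_avg X) -> norm_le X 2.
Proof.
move=> hE eX; have [k] := norm_le_exists X.
elim: k => [|k IH]; first by rewrite addr0.
move=> h; apply: IH; rewrite eX.
have p : 0 < 2 + k.+1%:R :> R by rewrite -natrD ltr0n.
apply: norm_le_weaken (norm_leD hE (compress_avg_dist p h)).
by rewrite -natr1; have : 0 <= k%:R :> R by []; lra.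
Qed.

Lemma compress_avgZ t X : compress_avg (t *: X) = t *: compress_avg X.
Proof. exact: linearZ. Qed.

Lemma compress_avgB X Y : compress_avg (X - Y) = compress_avg X - compress_avg Y.
Proof. exact: linearB. Qed.

(** Every positive multiple of a kernel element satisfies the fixed-point equation with $E=0$, so
    all these multiples are bounded by 2. *)
Lemma compress_avg_inj X : compress_avg X = 0 -> X = 0.
Proof.
move=> X0; have h t : 0 < t -> norm_le (t%:C *: X) 2.
  move=> t0; apply: (@fixpoint_norm_le _ 0).
    move=> u v; rewrite mul0mx /cdot mulmx0 /adjmx map_mx0 trmx0 mul0mx mxE addr0.
    by rewrite mulr_ge0 ?ler0c // addr_ge0 ?cdot_ge0.
  by rewrite compress_avgZ X0 scaler0 subr0 add0r.
suff Xv (v : 'cV[C]_D) : X *m v = 0.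
  apply/matrixP => i j; have := Xv (delta_mx j 0); rewrite -colE => /colP/(_ i).
  by rewrite !mxE.
apply: cdot_eq0; rewrite -cdot_real; congr (real_complex R _).
have Re0 (w : 'cV[C]_D) : 0 <= complex.Re (cdot w w).
  by have := cdot_ge0 w; rewrite -cdot_real ler0c.
have := Re0 (X *m v); have := Re0 v.
set x := complex.Re (cdot (X *m v) _); set y := complex.Re (cdot v v) => y0 x0.
apply/eqP; rewrite eq_le x0 andbT leNgt; apply/negP => xp.
(* At this multiple [t], testing with $u=Xv$ would give $2tx=4(x+y)\le2(x+y)$. *)
have t0 : 0 < 2 * (x + y) / x by rewrite divr_gt0 // mulr_gt0 // ltr_wpDr.
have := h _ t0 (X *m v) v.
rewrite -scalemxAl cdotZr cdotZl conjc_real -(cdot_real (X *m v)) -(cdot_real v) -/x -/y -!rmorphM -!rmorphD -rmorphM lecR.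
have -> : 2 * (x + y) / x * x = 2 * (x + y) by rewrite divfK // gt_eqF.
by lra.
Qed.

Lemma compress_avg_adj X : compress_avg (adjmx X) = adjmx (compress_avg X).
Proof.
have Qh s : adjmx (Q s) = Q s.
  by rewrite /Q -[in RHS](Ph s) /adjmx map_mxB map_mx1 linearB /= trmx1.
rewrite /compress_avg; apply/matrixP => i j; rewrite /adjmx !mxE conjcM conjc_inv conjc_nat.
congr (_ * _); rewrite !summxE conjc_sum; apply: eq_bigr => s _.
have -> : Q s *m (map_mx conjc X)^T *m Q s = adjmx (Q s *m X *m Q s).
  by rewrite !adjmxM !Qh mulmxA.
by rewrite /adjmx !mxE.
Qed.

Lemma compress_avg_surj Y : exists X, compress_avg X = Y.
Proof.
have free : row_free (lin_mx compress_avg).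
  apply: inj_row_free => u; rewrite mul_rV_lin => h.
  have /compress_avg_inj E : compress_avg (vec_mx u) = 0 by apply: (can_inj mxvecK); rewrite h linear0.
  by rewrite -[u]vec_mxK E linear0.
exists (vec_mx (mxvec Y *m invmx (lin_mx compress_avg))); apply: (can_inj mxvecK).
by rewrite -mul_rV_lin mulmxKV // -row_free_unit.
Qed.

Lemma exclusion_povm : exists T : I -> 'M[C]_D,
  [/\ forall s, psdmx (T s), \sum_(s in S) T s = 1%:M & forall s, T s *m P s = 0].
Proof.
have [X eX] := compress_avg_surj 1%:M.
have hX : adjmx X = X.
  apply/eqP; rewrite -subr_eq0; apply/eqP; apply: compress_avg_inj.
  rewrite compress_avgB compress_avg_adj eX.
  by rewrite /adjmx map_mx1 trmx1 subrr.
(* [X] is bounded by 2 and [compress_avg] moves it by at most a quarter of that. *)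
have dX : norm_le (X - 1%:M) (2^-1).
  have X2 : norm_le X 2 by apply: fixpoint_norm_le norm_le1 _; rewrite eX addrC subrK.
  by rewrite -eX; apply: norm_le_weaken (compress_avg_dist _ X2) => //; lra.
(* Testing at the pair $(-v,v)$ gives $\langle v,Xv\rangle\ge\frac12\|v\|^2$. *)
have pX v : 0 <= cdot v (X *m v).
  have := dX (- v) v; rewrite !cdotNl !cdotNr opprK mulmxBl mul1mx cdotBr cdotBl.
  have -> : (2^-1 : R)%:C = 2^-1 by rewrite fmorphV rmorph_nat.
  rewrite [cdot (X *m v) v]cdot_adj hX -subr_ge0 => h.
  rewrite -(@pmulr_rge0 _ 2) //; apply: le_trans (cdot_ge0 v) _.
  rewrite -subr_ge0; apply: le_trans h _.
  by rewrite le_eqVlt; apply/orP; left; apply/eqP; field.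
have nN : (#|S|%:R : C) != 0 by rewrite pnatr_eq0 -lt0n.
have Qh s : adjmx (Q s) = Q s.
  by rewrite /Q -[in RHS](Ph s) /adjmx map_mxB map_mx1 linearB /= trmx1.
exists (fun s => (#|S|%:R)^-1 *: (Q s *m X *m Q s)); split.
- move=> s v; rewrite -scalemxAl cdotZr mulr_ge0 ?invr_ge0 ?ler0n //.
  by rewrite -!mulmxA -{1}(Qh s) -cdot_adj; exact: pX.
- by rewrite -scaler_sumr -/(compress_avg X) eX.
- move=> s; have QP : Q s *m P s = 0 by rewrite mulmxBl mul1mx PP subrr.
  by rewrite -scalemxAl -mulmxA QP mulmx0 scaler0.
Qed.

End NeumannInversion.

Lemma exp_beats_poly (R : realType) (a : nat) (c : R) : 0 < c -> c < a%:R ->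
  exists n, 12%:R * n.+1%:R ^+ a * c ^+ n <= a%:R ^+ n.
Proof.
move=> c0 ca; pose y := a%:R / c; pose x := y - 1.
have x0 : 0 < x by rewrite subr_gt0 ltr_pdivlMr ?mul1r.
have bern k : 1 + k%:R * x <= y ^+ k.
  elim: k => [|k IH]; first by rewrite mul0r addr0 expr0.
  have -> : y = 1 + x by rewrite /x addrC subrK.
  rewrite exprS -[X in X ^+ k](_ : y = _); last by rewrite /x addrC subrK.
  apply: le_trans (ler_wpM2l _ IH); last by rewrite addr_ge0 // ltW.
  rewrite -natr1; have kp : 0 <= k%:R :> R by [].
  by have := mulr_ge0 kp (sqr_ge0 x); nra.
have [k hk] : exists k, 2 ^+ a.+1 <= y ^+ k.
  exists (Num.Def.archi_bound (2 ^+ a.+1 / x)); apply: le_trans (bern _).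
  rewrite -[X in X <= _]add0r lerD // -ler_pdivrMr // ltW // archi_boundP //.
  by rewrite divr_ge0 ?exprn_ge0 // ltW.
(* With $n=km$ one has $12(n+1)^a\le12\,((k+1)2^m)^a=m\,2^{ma}\le2^{(a+1)m}\le y^n$. *)
pose m := (12 * k.+1 ^ a)%N; exists (k * m)%N.
rewrite -ler_pdivlMr ?exprn_gt0 // -expr_div_n -/y exprM.
have y0 : 0 <= y by rewrite divr_ge0 // ltW.
apply: (@le_trans _ _ ((2 ^+ a.+1) ^+ m)); last first.
  by apply: lerXn2r; rewrite ?nnegrE ?exprn_ge0.
rewrite -!natrX -natrM ler_nat -expnM.
have h1 : ((k * m).+1 <= k.+1 * 2 ^ m)%N.
  by have := ltn_expl m (isT : 1 < 2)%N; move: (2 ^ m)%N => z; nia.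
apply: (@leq_trans (12 * (k.+1 * 2 ^ m) ^ a)); first by rewrite leq_mul2l; case: (a) => [|a'] //; rewrite leq_exp2r.
rewrite expnMn mulnA -/m mulSn expnD -expnM [(m * a)%N]mulnC leq_mul2r.
by rewrite (ltnW (ltn_expl m (isT : 1 < 2)%N)) orbT.
Qed.

(** * Type classes of strings *)

Section TypeClasses.
Variables (a n : nat).

Definition letter_counts (s : n.-tuple 'I_a) : {ffun 'I_a -> 'I_n.+1} :=
  [ffun k => inord (count_mem k s)].

Lemma same_typeE s t : same_type s t = (letter_counts s == letter_counts t).
Proof.
have le k (u : n.-tuple 'I_a) : (count_mem k u < n.+1)%N.
  by rewrite ltnS -[X in (_ <= X)%N](size_tuple u) count_size.
apply/forallP/eqP => [h|h k]; first by apply/ffunP => k; rewrite !ffunE (eqP (h k)).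
have := congr1 (fun f : {ffun 'I_a -> 'I_n.+1} => val (f k)) h.
by rewrite !ffunE /= !inordK // => ->.
Qed.

(** Pigeonhole: there are at most $(n+1)^a$ types, each letter count lying between 0 and [n]. *)
Lemma large_type_class : (0 < a)%N ->
  exists t : n.-tuple 'I_a, (a ^ n <= n.+1 ^ a * #|[set s | same_type s t]|)%N.
Proof.
move=> a0; pose t0 : n.-tuple 'I_a := nseq_tuple n (Ordinal a0).
pose size_class t := #|[set s : n.-tuple 'I_a | same_type s t]|.
case: (arg_maxnP (P := xpredT) size_class (i0 := t0) isT) => t _ tmax; exists t.
have -> : (a ^ n = #|{: n.-tuple 'I_a}|)%N by rewrite card_tuple card_ord.
have -> : (n.+1 ^ a = #|{: {ffun 'I_a -> 'I_n.+1}}|)%N by rewrite card_ffun !card_ord.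
rewrite -[X in (X <= _)%N]sum1_card [X in (X <= _)%N](partition_big letter_counts xpredT) //=.
have -> : forall k, (#|{: {ffun 'I_a -> 'I_n.+1}}| * k =
    \sum_(tau : {ffun 'I_a -> 'I_n.+1}) k)%N by move=> k; rewrite sum_nat_const.
apply: leq_sum => tau _; rewrite sum1_card.
case: (pickP (fun s => letter_counts s == tau)) => [s /eqP <-|no]; last first.
  by rewrite eq_card0 // => s; rewrite inE no.
apply: leq_trans (tmax s isT); apply: subset_leq_card; apply/fintype.subsetP => u.
by rewrite !inE same_typeE.
Qed.

End TypeClasses.

(** * Conclusive exclusion of a large type class *)

Section Exclusion.
Variables (R : realType) (a d : nat) (rho P : 'I_a -> 'M[R[i]]_d).
Local Notation C := R[i].

(** The sum over strings is a tensor power of the sum over letters; the induction treats the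
    remaining positions first and then the first one, slice by slice. *)
Lemma tensor_proj_bound (c : C) : 0 <= c ->
  (forall v : 'cV[C]_d, \sum_i cdot (P i *m v) (P i *m v) <= c * cdot v v) ->
  forall n (u : n.-tuple 'I_d -> C),
  \sum_(s : n.-tuple 'I_a) \sum_x conjc (\sum_y prodstate P s x y * u y) * \sum_y prodstate P s x y * u y
  <= c ^+ n * \sum_x conjc (u x) * u x.
Proof.
move=> c0 hc; elim=> [|n IH] u.
  rewrite (big_pred1 [tuple]) => [|s]; last by rewrite [s]tuple0; apply/esym/eqP; exact: val_inj.
  rewrite expr0 mul1r le_eqVlt; apply/orP; left; apply/eqP; apply: eq_bigr => x _.
  suff -> : \sum_y prodstate P [tuple] x y * u y = u x by [].
  rewrite (big_pred1 x) => [|y]; last by rewrite [x]tuple0 [y]tuple0; apply/esym/eqP; exact: val_inj.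
  by rewrite /prodstate big_ord0 mul1r.
(* The slice at [o] of $P_i\otimes\mathbb{1}$ applied to [u]. *)
pose U i o (y : n.-tuple 'I_d) := \sum_o' P i o o' * u [tuple of o' :: y].
rewrite big_tuple_cons.
apply: (@le_trans _ _ (\sum_i \sum_o c ^+ n * \sum_y conjc (U i o y) * U i o y)).
  apply: ler_sum => i _; under eq_bigr do rewrite big_tuple_cons.
  rewrite exchange_big; apply: ler_sum => o _; apply: le_trans (IH (U i o)).
  rewrite le_eqVlt; apply/orP; left; apply/eqP.
  apply: eq_bigr => s _; apply: eq_bigr => x _.
  suff -> : \sum_y prodstate P [tuple of i :: s] [tuple of o :: x] y * u y =
            \sum_y prodstate P s x y * U i o y by [].
  rewrite big_tuple_cons exchange_big; apply: eq_bigr => y _.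
  by rewrite mulr_sumr; apply: eq_bigr => o' _; rewrite prodstate_cons; ring.
under eq_bigr do rewrite -mulr_sumr; rewrite -mulr_sumr exprSr -mulrA.
rewrite ler_wpM2l ?exprn_ge0 // [X in _ * X]big_tuple_cons.
have swap (F : 'I_a -> 'I_d -> n.-tuple 'I_d -> C) :
    \sum_i \sum_o \sum_y F i o y = \sum_y \sum_i \sum_o F i o y.
  by rewrite [RHS]exchange_big; apply: eq_bigr => i _; rewrite [RHS]exchange_big.
rewrite swap [X in _ * X]exchange_big mulr_sumr; apply: ler_sum => y _.
have := hc (\col_o u [tuple of o :: y]); rewrite cdotE.
under [X in _ * X]eq_bigr do rewrite mxE.
apply: le_trans; rewrite le_eqVlt; apply/orP; left; apply/eqP; apply: eq_bigr => i _.
rewrite cdotE; apply: eq_bigr => o _; rewrite mxE.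
by under [in RHS]eq_bigr do rewrite mxE.
Qed.

Lemma supp_proj_fix n (Q r : 'M[C]_n) : is_supp_proj Q r -> Q *m r = r.
Proof.
move=> [QQ [_ rg]]; apply/matrixP => i j.
have : mxrange r (col j r) by exists (delta_mx j 0); rewrite colE.
rewrite -rg => -[w ew].
have : Q *m col j r = col j r by rewrite ew mulmxA QQ.
by rewrite !colE mulmxA -!colE => /colP/(_ i); rewrite !mxE.
Qed.

Lemma mxrange_supp n (Q r : 'M[C]_n) v : is_supp_proj Q r -> mxrange r v <-> Q *m v = v.
Proof.
move=> h; have [QQ [_ rg]] := h; split=> [|<-]; last by rewrite -rg; exists v.
by rewrite -rg => -[w ->]; rewrite mulmxA QQ.
Qed.

Lemma trivial_cap_excludable :
  (0 < a)%N -> (forall i, is_supp_proj (P i) (rho i)) ->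
  (forall v : 'cV[C]_d, (forall i, P i *m v = v) -> v = 0) ->
  exists n (t : n.-tuple 'I_a), type_excludable rho t.
Proof.
move=> a0 sp cap.
have PP i : P i *m P i = P i by have [] := sp i.
have Ph i : adjmx (P i) = P i by have [_ []] := sp i.
have [c [c0 ca gap _]] := proj_sum_gap a0 PP Ph cap.
have [n hn] := exp_beats_poly c0 ca.
have [t ht] := @large_type_class a n a0.
exists n, t; pose S := [set s : n.-tuple 'I_a | same_type s t].
pose Pm (s : n.-tuple 'I_a) : 'M[C]_#|{: n.-tuple 'I_d}| :=
  \matrix_(i, j) prodstate P s (enum_val i) (enum_val j).
have S0 : (0 < #|S|)%N.
  apply/card_gt0P; exists t; rewrite inE; exact/forallP.
have PmPm s : Pm s *m Pm s = Pm s.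
  apply/matrixP => i j; rewrite !mxE.
  have := congr1 (fun f => f (enum_val i) (enum_val j)) (prodstate_mul P P s).
  rewrite (eq_prodstate s PP) => <-; rewrite /opmul [RHS]sum_enum_val.
  by apply: eq_bigr => k _; rewrite !mxE.
have Pmh s : adjmx (Pm s) = Pm s.
  apply/matrixP => i j; rewrite !mxE.
  by have := congr1 (fun f => f (enum_val i) (enum_val j)) (prodstate_adj P s);
    rewrite (eq_prodstate s Ph).
have small (v : 'cV[C]_#|{: n.-tuple 'I_d}|) :
  \sum_(s in S) cdot (Pm s *m v) (Pm s *m v) <= (12%:R)^-1 * #|S|%:R * cdot v v.
  have gapP (w : 'cV[C]_d) : \sum_i cdot (P i *m w) (P i *m w) <= real_complex R c * cdot w w.
    apply: le_trans (gap w); rewrite mulmx_suml cdot_sumr le_eqVlt.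
    by apply/orP; left; apply/eqP; apply: eq_bigr => i _; rewrite -cdot_proj.
  have cc0 : 0 <= real_complex R c by rewrite ler0c ltW.
  have := tensor_proj_bound cc0 gapP (fun x => v (enum_rank x) 0).
  have -> : \sum_(x : n.-tuple 'I_d) conjc (v (enum_rank x) 0) * v (enum_rank x) 0 = cdot v v.
    by rewrite cdotE sum_enum_val; apply: eq_bigr => k _; rewrite enum_valK.
  have E s : cdot (Pm s *m v) (Pm s *m v) =
     \sum_x conjc (\sum_y prodstate P s x y * v (enum_rank y) 0) *
        \sum_y prodstate P s x y * v (enum_rank y) 0.
    rewrite cdotE [RHS]sum_enum_val; apply: eq_bigr => k _.
    have -> : (Pm s *m v) k 0 = \sum_y prodstate P s (enum_val k) y * v (enum_rank y) 0.
      by rewrite mxE [RHS]sum_enum_val; apply: eq_bigr => l _; rewrite mxE enum_valK.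
    by [].
  under eq_bigr do rewrite -E.
  move=> h; apply: (@le_trans _ _ (\sum_s cdot (Pm s *m v) (Pm s *m v))).
    by rewrite [X in _ <= X](bigID (mem S)) /= lerDl sumr_ge0 // => s _; exact: cdot_ge0.
  apply: le_trans h _; rewrite ler_wpM2r ?cdot_ge0 // mulrC ler_pdivlMr //.
  (* Follows from $12(n+1)^ac^n\le a^n\le(n+1)^a|S|$ by cancelling $(n+1)^a$. *)
  have : c ^+ n * 12%:R <= #|S|%:R.
    have q0 : 0 < n.+1%:R ^+ a :> R by rewrite exprn_gt0.
    rewrite -(ler_pM2l q0) mulrA [_ * 12%:R]mulrC mulrA; apply: le_trans hn _.
    by rewrite -!natrX -natrM ler_nat.
  by rewrite -(lecR (c ^+ n * 12%:R)) rmorphM rmorphXn !rmorph_nat.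
have [T [pT sT TP]] := exclusion_povm S0 PmPm Pmh small.
exists (fun s u v => T s (enum_rank u) (enum_rank v)); split; [|split].
- move=> s _ v; rewrite sum_enum_val.
  have /psdmx_op /(_ (fun i => v (enum_val i))) := pT s.
  congr (0 <= _); apply: eq_bigr => i _; rewrite [RHS]sum_enum_val; apply: eq_bigr => j _.
  by rewrite !enum_valK.
- move=> u v; rewrite /opid -(inj_eq enum_rank_inj).
  have := congr1 (fun M : 'M_ _ => M (enum_rank u) (enum_rank v)) sT.
  rewrite summxE mxE => <-; apply: eq_bigl => s; by rewrite inE.
- move=> s _; rewrite optrC.
  set M := fun _ _ => _.
  have MP : opmul M (prodstate P s) = fun _ _ => 0.
    apply: funext => u; apply: funext => v.
    have := congr1 (fun N : 'M_ _ => N (enum_rank u) (enum_rank v)) (TP s).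
    rewrite !mxE /opmul => h; rewrite [LHS]sum_enum_val -[RHS]h; apply: eq_bigr => k _.
    by rewrite /M !mxE !enum_rankK enum_valK.
  (* The states absorb their support projectors, so annihilating $P_s$ suffices. *)
  have -> : prodstate rho s = opmul (prodstate P s) (prodstate rho s).
    by rewrite prodstate_mul; apply: eq_prodstate => i; rewrite supp_proj_fix.
  rewrite opmulA MP /optr big1 // => u _; rewrite /opmul big1 // => v _.
  by rewrite mul0r.
Qed.

End Exclusion.

(** * The converse *)

Section PositiveMaps.
Variable R : realType.
Local Notation C := R[i].

Lemma psd_conj (I J : finType) (V : op R I J) (s : op R J J) : oppsd s ->
  oppsd (opmul (opmul V s) (opadj V)).
Proof.
move=> /psd_factor[B ->].
have -> : opmul (opmul V (opmul (opadj B) B)) (opadj V) =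
          opmul (opadj (opmul B (opadj V))) (opmul B (opadj V)).
  by rewrite opadjM opadjK !opmulA.
exact: psd_gram.
Qed.

Lemma psd_sum (I K : finType) (A : K -> op R I I) : (forall k, oppsd (A k)) ->
  oppsd (fun i j => \sum_k A k i j).
Proof.
move=> pA v.
have -> : \sum_i \sum_j conjc (v i) * (\sum_k A k i j) * v j =
          \sum_k \sum_i \sum_j conjc (v i) * A k i j * v j.
  rewrite [RHS]exchange_big; apply: eq_bigr => i _.
  rewrite [RHS]exchange_big; apply: eq_bigr => j _.
  by rewrite mulr_sumr mulr_suml.
by apply: sumr_ge0 => k _; exact: pA.
Qed.

Lemma psd_add (I : finType) (A B : op R I I) : oppsd A -> oppsd B ->
  oppsd (fun i j => A i j + B i j).
Proof.
move=> pA pB v.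
have -> : \sum_i \sum_j conjc (v i) * (A i j + B i j) * v j =
  (\sum_i \sum_j conjc (v i) * A i j * v j) + \sum_i \sum_j conjc (v i) * B i j * v j.
  rewrite -big_split; apply: eq_bigr => i _; rewrite -big_split; apply: eq_bigr => j _.
  by rewrite /=; ring.
exact: addr_ge0.
Qed.

Lemma psd_scale (I : finType) (A : op R I I) (c : C) : 0 <= c -> oppsd A ->
  oppsd (fun i j => c * A i j).
Proof.
move=> c0 pA v.
have -> : \sum_i \sum_j conjc (v i) * (c * A i j) * v j =
  c * \sum_i \sum_j conjc (v i) * A i j * v j.
  rewrite mulr_sumr; apply: eq_bigr => i _; rewrite mulr_sumr; apply: eq_bigr => j _; ring.
exact: mulr_ge0.
Qed.

Lemma psd_dyad (I : finType) (f : I -> C) : oppsd (fun i j => f i * conjc (f j)).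
Proof.
move=> v.
have -> : \sum_i \sum_j conjc (v i) * (f i * conjc (f j)) * v j =
   conjc (\sum_i conjc (f i) * v i) * \sum_j conjc (f j) * v j.
  rewrite conjc_sum mulr_suml; apply: eq_bigr => i _.
  by rewrite mulr_sumr; apply: eq_bigr => j _; rewrite conjcM conjcK; ring.
exact: conjM_ge0.
Qed.

Lemma eq_psd (I : finType) (A B : op R I I) : (forall i j, A i j = B i j) -> oppsd A -> oppsd B.
Proof. by move=> AB pA; have -> : B = A by apply: funext => i; apply: funext => j. Qed.

Definition density (I : finType) (s : op R I I) : Prop := oppsd s /\ optr s = 1.

Lemma density_isometry (I J : finType) (V : op R I J) (s : op R J J) :
  is_isometry V -> density s -> density (opmul (opmul V s) (opadj V)).
Proof.
move=> iV [ps ts]; split; first exact: psd_conj.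
by rewrite optrC opmulA iV opmul1l.
Qed.

Section AliceBob.
Variables (Xo Fo Y A Xn : finType) (U : op R (A * Xn)%type (Xo * Fo)%type).

(** The operator $U\otimes\mathbb{1}_Y$, which exhibits Alice's step as a conjugation and so reduces
    positivity and trace to general facts. *)
Definition alice_op : op R (A * Xn * Y)%type (Xo * Fo * Y)%type :=
  fun p q => U p.1 q.1 * (p.2 == q.2)%:R.

Lemma sum_alice_op (p : A * Xn * Y) (G : Xo * Fo * Y -> C) :
  \sum_z alice_op p z * G z = \sum_xf U p.1 xf * G (xf, p.2).
Proof.
rewrite sum_pair; apply: eq_bigr => xf _.
rewrite -[RHS](sum_delta p.2 (fun y => U p.1 xf * G (xf, y))).
by apply: eq_bigr => y _; rewrite /alice_op /=; ring.
Qed.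

Lemma sum_alice_op_conj (p : A * Xn * Y) (G : Xo * Fo * Y -> C) :
  \sum_z G z * conjc (alice_op p z) = \sum_xf G (xf, p.2) * conjc (U p.1 xf).
Proof.
rewrite sum_pair; apply: eq_bigr => xf _.
rewrite -[RHS](sum_delta p.2 (fun y => G (xf, y) * conjc (U p.1 xf))).
by apply: eq_bigr => y _; rewrite /alice_op conjcM conjc_delta /=; ring.
Qed.

Lemma alice_stepE (r : jstate R Xo Fo Y) :
  alice_step U r = opmul (opmul alice_op r) (opadj alice_op).
Proof.
apply: funext => p; apply: funext => q; rewrite /opmul /opadj sum_alice_op_conj.
rewrite /alice_step exchange_big; apply: eq_bigr => xf' _.
by rewrite sum_alice_op mulr_suml.
Qed.

Lemma alice_op_isometry : is_isometry U -> is_isometry alice_op.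
Proof. exact: isometry_tensor_id. Qed.

End AliceBob.

Section Bob.
Variables (Bo Xn Y Fn Yn : finType) (W : op R (Fn * Yn)%type (Y * Bo)%type).

Definition bob_op : op R (Xn * Fn * Yn)%type (Bo * Xn * Y)%type :=
  fun p q => W (p.1.2, p.2) (q.2, q.1.1) * (p.1.1 == q.1.2)%:R.

Lemma sum_bob_op (p : Xn * Fn * Yn) (G : Bo * Xn * Y -> C) :
  \sum_z bob_op p z * G z = \sum_y \sum_o W (p.1.2, p.2) (y, o) * G ((o, p.1.1), y).
Proof.
rewrite sum_pair exchange_big; apply: eq_bigr => y _.
rewrite sum_pair; apply: eq_bigr => o _.
rewrite -[RHS](sum_delta p.1.1 (fun x => W (p.1.2, p.2) (y, o) * G ((o, x), y))).
by apply: eq_bigr => x _; rewrite /bob_op /=; ring.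
Qed.

Lemma sum_bob_op_conj (p : Xn * Fn * Yn) (G : Bo * Xn * Y -> C) :
  \sum_z G z * conjc (bob_op p z) =
  \sum_y \sum_o G ((o, p.1.1), y) * conjc (W (p.1.2, p.2) (y, o)).
Proof.
rewrite sum_pair exchange_big; apply: eq_bigr => y _.
rewrite sum_pair; apply: eq_bigr => o _.
rewrite -[RHS](sum_delta p.1.1 (fun x => G ((o, x), y) * conjc (W (p.1.2, p.2) (y, o)))).
by apply: eq_bigr => x _; rewrite /bob_op conjcM conjc_delta /=; ring.
Qed.

Lemma bob_stepE (s : op R (Bo * Xn * Y)%type (Bo * Xn * Y)%type) :
  bob_step W s = opmul (opmul bob_op s) (opadj bob_op).
Proof.
apply: funext => p; apply: funext => q; rewrite /opmul /opadj sum_bob_op_conj.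
have swap (F : Y -> Bo -> Y -> Bo -> C) : \sum_y \sum_o \sum_y' \sum_o' F y o y' o' =
    \sum_y' \sum_o' \sum_y \sum_o F y o y' o'.
  transitivity (\sum_y \sum_y' \sum_o \sum_o' F y o y' o').
    by apply: eq_bigr => y _; exact: exchange_big.
  rewrite exchange_big; apply: eq_bigr => y' _.
  transitivity (\sum_y \sum_o' \sum_o F y o y' o').
    by apply: eq_bigr => y _; exact: exchange_big.
  exact: exchange_big.
rewrite /bob_step swap; apply: eq_bigr => y' _; apply: eq_bigr => o' _.
by rewrite sum_bob_op mulr_suml; apply: eq_bigr => y _; rewrite mulr_suml.
Qed.

Lemma bob_op_isometry : is_isometry W -> is_isometry bob_op.
Proof.
move=> iW; apply: funext => -[[o x] y]; apply: funext => -[[o' x'] y'].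
have := congr1 (fun f => f (y, o) (y', o')) iW.
rewrite /opmul /opadj /opid !xpair_eqE sum_pair => h.
transitivity (\sum_f \sum_z conjc (W (f, z) (y, o)) * W (f, z) (y', o') * (x == x')%:R).
  rewrite sum_pair sum_pair exchange_big; apply: eq_bigr => f _.
  rewrite exchange_big; apply: eq_bigr => z _.
  rewrite -[RHS]mulrC -[RHS](sum_delta x (fun x1 => (x1 == x')%:R *
     (conjc (W (f, z) (y, o)) * W (f, z) (y', o')))).
  by apply: eq_bigr => x1 _; rewrite /bob_op conjcM conjc_delta /= eq_sym; ring.
under eq_bigr do rewrite -mulr_suml.
rewrite -mulr_suml h -natrM mulnb; congr (nat_of_bool _)%:R.
by case: (y == y'); case: (o == o'); case: (x == x').
Qed.

End Bob.

Section Channel.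
Variables (In Out X Y : finType) (st : In -> op R Out Out).
Local Notation step := (@channel_step R (CQChan st) X Y).

(** Kraus form: writing $\mathrm{st}_i=B_i^\dagger B_i$, the operator [V (i, k)] reads [i] at the
    input and emits the conjugate of row [k] of $B_i$. *)
Lemma channel_step_psd s : (forall i, oppsd (st i)) -> oppsd s -> oppsd (step s).
Proof.
move=> pst ps.
have [B eB] := choice (fun i => psd_factor (pst i)).
pose V (ik : In * Out) : op R (Out * X * Y)%type (In * X * Y)%type :=
  fun p q => conjc (B ik.1 ik.2 p.1.1) * (((ik.1, p.1.2), p.2) == q)%:R.
apply: eq_psd (psd_sum (A := fun ik => opmul (opmul (V ik) s) (opadj (V ik))) _); last first.
  by move=> ik; exact: psd_conj.
move=> p q; rewrite sum_pair /channel_step /=; apply: eq_bigr => i _.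
have VL k (G : In * X * Y -> C) : \sum_z V (i, k) p z * G z =
    conjc (B i k p.1.1) * G ((i, p.1.2), p.2).
  rewrite -[RHS](sum_delta ((i, p.1.2), p.2) (fun z => conjc (B i k p.1.1) * G z)).
  by apply: eq_bigr => z _; rewrite /V /=; ring.
have VR k (G : In * X * Y -> C) : \sum_z G z * conjc (V (i, k) q z) =
    G ((i, q.1.2), q.2) * B i k q.1.1.
  rewrite -[RHS](sum_delta ((i, q.1.2), q.2) (fun z => G z * B i k q.1.1)).
  by apply: eq_bigr => z _; rewrite /V conjcM conjcK conjc_delta /=; ring.
have -> : st i p.1.1 q.1.1 = \sum_k conjc (B i k p.1.1) * B i k q.1.1.
  by have := congr1 (fun f => f p.1.1 q.1.1) (eB i).
rewrite mulr_suml; apply: eq_bigr => k _.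
by rewrite /opmul /opadj VR VL; ring.
Qed.

Lemma channel_step_trace s : (forall i, optr (st i) = 1) -> optr (step s) = optr s.
Proof.
move=> tst; rewrite /optr /channel_step !sum_pair /=.
transitivity (\sum_i \sum_x \sum_y (\sum_o st i o o) * s ((i, x), y) ((i, x), y)).
  rewrite [LHS]exchange_big [RHS]exchange_big; apply: eq_bigr => x _.
  rewrite [LHS]exchange_big [RHS]exchange_big; apply: eq_bigr => y _.
  rewrite exchange_big; apply: eq_bigr => i _.
  by rewrite mulr_suml.
apply: eq_bigr => i _; apply: eq_bigr => x _; apply: eq_bigr => y _.
by rewrite -[\sum_o _]/(optr (st i)) tst mul1r.
Qed.

End Channel.

Lemma bob_marginal_psd (X F Y : finType) (s : jstate R X F Y) : oppsd s -> oppsd (bob_marginal s).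
Proof.
move=> ps.
pose V xf : op R Y (X * F * Y)%type := fun y q => ((xf, y) == q)%:R.
apply: eq_psd (psd_sum (A := fun xf => opmul (opmul (V xf) s) (opadj (V xf))) _); last first.
  by move=> xf; exact: psd_conj.
move=> y y'; apply: eq_bigr => xf _; rewrite /opmul /opadj /V.
under eq_bigr do rewrite sum_delta conjc_delta mulrC.
by rewrite sum_delta.
Qed.

Lemma bob_marginal_trace (X F Y : finType) (s : jstate R X F Y) : optr (bob_marginal s) = optr s.
Proof. by rewrite /optr sum_pair exchange_big. Qed.

End PositiveMaps.

(** * Domination and marginals through one round *)

Section Round.
Variables (R : realType) (In Out X F Y X' F' Y' : finType).
Variables (U : op R (In * X')%type (X * F)%type) (W : op R (F' * Y')%type (Y * Out)%type).
Local Notation C := R[i].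
Implicit Types (st : In -> op R Out Out) (s : jstate R X F Y).

Definition one_round st s : jstate R X' F' Y' :=
  bob_step W (@channel_step R (CQChan st) X' Y (alice_step U s)).

Lemma one_round_psd st s : (forall i, oppsd (st i)) -> oppsd s -> oppsd (one_round st s).
Proof.
move=> pst ps; rewrite /one_round bob_stepE; apply: psd_conj.
by apply: channel_step_psd => //; rewrite alice_stepE; exact: psd_conj.
Qed.

Lemma one_round_density st s : is_isometry U -> is_isometry W ->
  (forall i, density (st i)) -> density s -> density (one_round st s).
Proof.
move=> iU iW dst ds; rewrite /one_round bob_stepE; apply: density_isometry.
  exact: bob_op_isometry.
have [ps ts] := density_isometry (@alice_op_isometry R X F Y In X' U iU) ds.
rewrite alice_stepE; split; first by apply: channel_step_psd => // i; have [] := dst i.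
by rewrite channel_step_trace // => i; have [] := dst i.
Qed.

Lemma conj_lincomb (I J : finType) (V : op R I J) (k : C) (A B : op R J J) p q :
  opmul (opmul V (fun i j => k * A i j - B i j)) (opadj V) p q =
  k * opmul (opmul V A) (opadj V) p q - opmul (opmul V B) (opadj V) p q.
Proof.
rewrite /opmul mulr_sumr -sumrB; apply: eq_bigr => j _.
rewrite mulrA -mulrBl mulr_sumr -sumrB; congr (_ * _).
by apply: eq_bigr => i _; ring.
Qed.

Lemma one_round_dominated st st' s s' (k K : C) :
  0 <= k -> 0 <= K -> (forall i, oppsd (st i)) ->
  (forall i, oppsd (fun o o' => k * st' i o o' - st i o o')) ->
  oppsd s -> oppsd (fun p q => K * s' p q - s p q) ->
  oppsd (fun p q => k * K * one_round st' s' p q - one_round st s p q).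
Proof.
move=> k0 K0 pst pd ps psd.
pose al (s0 : jstate R X F Y) := alice_step U s0.
(* The difference splits as $kK\,N'(s')-N(s)=(kN'-N)(Ks')+N(Ks'-s)$, where $N,N'$ are the channels
   and Alice's step is applied to $s,s'$. Both terms are positive. *)
pose z : op R (Out * X' * Y)%type (Out * X' * Y)%type := fun p q =>
  @channel_step R (CQChan (fun i o o' => k * st' i o o' - st i o o')) X' Y
    (fun p q => K * al s' p q) p q +
  @channel_step R (CQChan st) X' Y (fun p q => K * al s' p q - al s p q) p q.
have pK : oppsd (fun p q => K * s' p q).
  by apply: eq_psd (psd_add psd ps) => p q; rewrite subrK.
have pA : oppsd (fun p q => K * al s' p q).
  apply: (eq_psd _ (psd_conj (alice_op (Y := Y) U) pK)) => p q.
  rewrite /al alice_stepE /opmul mulr_sumr; apply: eq_bigr => j _.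
  by rewrite mulrA mulr_sumr; congr (_ * _); apply: eq_bigr => l _; ring.
have pAd : oppsd (fun p q => K * al s' p q - al s p q).
  apply: (eq_psd _ (psd_conj (alice_op (Y := Y) U) psd)) => p q.
  by rewrite conj_lincomb /al !alice_stepE.
have pz : oppsd z by apply: psd_add; exact: channel_step_psd.
apply: (eq_psd _ (psd_conj (bob_op (Xn := X') W) pz)) => p q.
rewrite /one_round !bob_stepE -conj_lincomb.
congr (opmul (opmul _ _) _ _ _); apply: funext => p1; apply: funext => q1.
rewrite /z /channel_step /= mulr_sumr -sumrB -big_split; apply: eq_bigr => i _ /=.
by rewrite /al; ring.
Qed.

(** A constant channel discards Alice's input, and her isometry preserves the partial trace over her
    systems. Bob's marginal therefore evolves independently of [U], hence of the message. *)
Lemma one_round_marginal (D : op R Out Out) s : is_isometry U ->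
  bob_marginal (one_round (fun=> D) s) =
  fun y y' => \sum_f \sum_y1 \sum_o \sum_y2 \sum_o'
    W (f, y) (y1, o) * (D o o' * bob_marginal s y1 y2) * conjc (W (f, y') (y2, o')).
Proof.
move=> iU; apply: funext => y; apply: funext => y'.
have alice_marginal y1 y2 :
    \sum_ax alice_step U s (ax, y1) (ax, y2) = bob_marginal s y1 y2.
  rewrite /alice_step /= exchange_big; apply: eq_bigr => xf _.
  rewrite exchange_big /= -[RHS](sum_delta xf (fun xf' => s (xf, y1) (xf', y2))).
  apply: eq_bigr => xf' _.
  have := congr1 (fun f => f xf' xf) iU; rewrite /opmul /opadj /opid eq_sym => <-.
  by rewrite mulr_suml; apply: eq_bigr => ax _; ring.
rewrite /bob_marginal sum_pair exchange_big; apply: eq_bigr => f _.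
rewrite /one_round /bob_step /=.
rewrite exchange_big; apply: eq_bigr => y1 _; rewrite exchange_big; apply: eq_bigr => o _.
rewrite exchange_big; apply: eq_bigr => y2 _; rewrite exchange_big; apply: eq_bigr => o' _.
rewrite -mulr_suml -mulr_sumr; congr (_ * _ * _).
rewrite /channel_step /=.
under eq_bigr do rewrite -mulr_sumr; rewrite -mulr_sumr; congr (_ * _).
rewrite -[RHS]alice_marginal sum_pair; exact: exchange_big.
Qed.

End Round.

(** * Room for states with orthogonal ranges *)

Section Orthogonality.
Variable R : realType.
Local Notation C := R[i].

Lemma mxtrace_gram m n (X : 'M[C]_(m, n)) :
  \tr (adjmx X *m X) = \sum_j \sum_i conjc (X i j) * X i j.
Proof.
rewrite /mxtrace; apply: eq_bigr => j _; rewrite mxE; apply: eq_bigr => i _.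
by rewrite /adjmx !mxE.
Qed.

Lemma mxtrace_gram_ge0 m n (X : 'M[C]_(m, n)) : 0 <= \tr (adjmx X *m X).
Proof.
rewrite mxtrace_gram; apply: sumr_ge0 => j _; apply: sumr_ge0 => i _; exact: conjM_ge0.
Qed.

Lemma mxtrace_gram_eq0 m n (X : 'M[C]_(m, n)) : \tr (adjmx X *m X) = 0 -> X = 0.
Proof.
move/eqP; rewrite mxtrace_gram psumr_eq0; last first.
  by move=> j _; apply: sumr_ge0 => i _; exact: conjM_ge0.
move=> /allP h; apply/matrixP => i j; have := h j (mem_index_enum _).
rewrite /= psumr_eq0 => [/allP /(_ i (mem_index_enum _))|k _]; last exact: conjM_ge0.
by rewrite /= mulf_eq0 conjc_eq0 orbb mxE => /eqP.
Qed.

Lemma mxtrace_conj_ge0 n m (A : 'M[C]_n) (Z : 'M[C]_(n, m)) : psdmx A ->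
  0 <= \tr (adjmx Z *m A *m Z).
Proof.
move=> /psdmx_factor[B ->].
by rewrite mulmxA -adjmxM -mulmxA; exact: mxtrace_gram_ge0.
Qed.

Lemma psdmx_range_proj n (A : 'M[C]_n) : psdmx A ->
  exists P B, [/\ adjmx P = P, P *m P = P, P *m A = A & P = A *m B].
Proof.
move=> /psdmx_op/psd_range_proj[P [B [hP PP PA PB]]].
exists (\matrix_(i, j) P i j), (\matrix_(i, j) B i j); split; apply/matrixP => i j.
- by rewrite /adjmx !mxE; have := congr1 (fun f => f i j) hP.
- have := congr1 (fun f => f i j) PP; rewrite !mxE => <-; apply: eq_bigr => k _.
  by rewrite !mxE.
- have := congr1 (fun f => f i j) PA; rewrite !mxE => <-; apply: eq_bigr => k _.
  by rewrite !mxE.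
- have := congr1 (fun f => f i j) PB; rewrite !mxE => ->; apply: eq_bigr => k _.
  by rewrite !mxE.
Qed.

Lemma adjmxB m n (A B : 'M[C]_(m, n)) : adjmx (A - B) = adjmx A - adjmx B.
Proof. by rewrite /adjmx map_mxB linearB. Qed.

Lemma adjmx1 n : adjmx (1%:M : 'M[C]_n) = 1%:M.
Proof. by rewrite /adjmx map_mx1 trmx1. Qed.

(** The range projections $P_m$ of $\tau_m$ are mutually orthogonal and contain the supports of
    $\sigma_m$. Hence $1=\mathrm{tr}\,\sigma_mP_m\le B\,\mathrm{tr}\,\gamma P_m$, and summing over
    [m] gives at most $B\,\mathrm{tr}\,\gamma$. *)
Lemma orth_states_bound M D (tau sigma : 'I_M -> 'M[C]_D) (gamma : 'M[C]_D) (K B : C) :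
  0 <= B -> (forall m, psdmx (tau m)) -> (forall m, psdmx (sigma m)) ->
  (forall m, \tr (sigma m) = 1) -> psdmx gamma -> \tr gamma = 1 ->
  (forall m, psdmx (K *: tau m - sigma m)) -> (forall m, psdmx (B *: gamma - sigma m)) ->
  (forall m m', m != m' -> adjmx (tau m) *m tau m' = 0) ->
  M%:R <= B.
Proof.
move=> B0 ptau psig tsig pgam tgam dtau dgam orth.
have [P hP] := choice (fun m => psdmx_range_proj (ptau m)).
have Ph m : adjmx (P m) = P m by have [Z []] := hP m.
have PP m : P m *m P m = P m by have [Z []] := hP m.
have Ptau m : P m *m tau m = tau m by have [Z []] := hP m.
have Porth m m' : m != m' -> P m *m P m' = 0.
  move=> mm'; have [Z [_ _ _ eZ]] := hP m; have [Z' [_ _ _ eZ']] := hP m'.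
  by rewrite -(Ph m) eZ eZ' adjmxM mulmxA -(mulmxA _ (adjmx _)) orth // mulmx0 mul0mx.
(* Compressing $K\tau_m-\sigma_m\ge0$ by $Z=\mathbb{1}-P_m$ removes $\tau_m$ and leaves
   $-Z\sigma_mZ\ge0$, which forces $\sigma_mZ=0$. *)
have sigP m : sigma m *m P m = sigma m.
  have [Z eZ] : exists Z, Z = 1%:M - P m by eexists.
  have hZ : adjmx Z = Z by rewrite eZ adjmxB adjmx1 Ph.
  have tauZ : adjmx Z *m tau m = 0 by rewrite hZ eZ mulmxBl mul1mx Ptau subrr.
  have [S eS] := psdmx_factor (psig m).
  have := mxtrace_conj_ge0 Z (dtau m).
  rewrite mulmxBr mulmxBl -scalemxAr tauZ scaler0 mul0mx sub0r raddfN /= oppr_ge0 => le0.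
  have SZ : S *m Z = 0.
    apply: mxtrace_gram_eq0; apply/eqP; rewrite eq_le mxtrace_gram_ge0 andbT.
    by rewrite adjmxM -mulmxA (mulmxA _ S) -eS mulmxA.
  apply/eqP; rewrite -subr_eq0 -oppr_eq0 opprB -{1}[sigma m]mulmx1 -mulmxBr.
  by rewrite -eZ eS -mulmxA SZ mulmx0.
have trPP (A : 'M[C]_D) Q : Q *m Q = Q -> \tr (Q *m A *m Q) = \tr (A *m Q).
  by move=> QQ; rewrite -mulmxA mxtrace_mulC -mulmxA QQ.
have one_le m : 1 <= B * \tr (gamma *m P m).
  have := mxtrace_conj_ge0 (P m) (dgam m).
  rewrite Ph trPP // mulmxBl -scalemxAl sigP raddfB /= linearZ /= tsig subr_ge0.
  by [].
pose Ps := \sum_m P m.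
have Psh : adjmx Ps = Ps.
  apply/matrixP => i j; rewrite /adjmx !mxE !summxE conjc_sum; apply: eq_bigr => m _.
  by rewrite -[in RHS](Ph m) /adjmx !mxE.
have PsPs : Ps *m Ps = Ps.
  rewrite /Ps mulmx_suml; apply: eq_bigr => m _; rewrite mulmx_sumr (bigD1 m) //= PP.
  by rewrite big1 ?addr0 // => m' mm'; rewrite Porth // eq_sym.
have QQ : (1%:M - Ps) *m (1%:M - Ps) = 1%:M - Ps.
  by rewrite mulmxBr mulmx1 mulmxBl mul1mx PsPs subrr subr0.
have := mxtrace_conj_ge0 (1%:M - Ps) pgam.
rewrite adjmxB adjmx1 Psh trPP // mulmxBr mulmx1 raddfB /= tgam subr_ge0 => le1.
apply: (@le_trans _ _ (B * \tr (gamma *m Ps))); last by rewrite ler_piMr.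
rewrite /Ps mulmx_sumr raddf_sum mulr_sumr.
have -> : M%:R = \sum_(m < M) (1 : C) by rewrite sumr_const card_ord.
by apply: ler_sum => m _; exact: one_le.
Qed.

Lemma cauchy_schwarz n (x y : 'cV[C]_n) : cdot x y * cdot y x <= cdot x x * cdot y y.
Proof.
have [y0|y0] := eqVneq (cdot y y) 0.
  by rewrite (cdot_eq0 y0) /cdot !mulmx0 !mxE mul0r mulr0.
have yp : 0 < cdot y y by rewrite lt_def y0 cdot_ge0.
have := cdot_ge0 (cdot y y *: x - cdot y x *: y).
rewrite cdotBl !cdotBr !cdotZl !cdotZr !conjc_cdot => h.
rewrite -subr_ge0 -(pmulr_rge0 _ yp); apply: le_trans h _.
by rewrite le_eqVlt; apply/orP; left; apply/eqP; ring.
Qed.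

(** With $r=B^\dagger B$ and $\beta=rw$, Cauchy-Schwarz gives $|\langle v,\beta\rangle|^2=|\langle
    Bv,Bw\rangle|^2\le\|Bw\|^2\langle v,rv\rangle$. *)
Lemma range_dominates n (r : 'M[C]_n) (beta : 'cV[C]_n) : psdmx r -> mxrange r beta ->
  exists K : C, 0 <= K /\ psdmx (K *: r - beta *m adjmx beta).
Proof.
move=> pr [w eb]; have [B eB] := psdmx_factor pr.
exists (cdot (B *m w) (B *m w)); split; first exact: cdot_ge0.
move=> v; rewrite mulmxBl cdotBr -scalemxAl cdotZr subr_ge0.
have -> : cdot v (beta *m adjmx beta *m v) = cdot v beta * cdot beta v.
  by rewrite /cdot -mulmxA mulmxA [LHS]mxE big_ord1.
have e1 : cdot v beta = cdot (B *m v) (B *m w) by rewrite cdot_adj mulmxA -eB eb.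
have e2 : cdot beta v = cdot (B *m w) (B *m v) by rewrite -conjc_cdot e1 conjc_cdot.
have e3 : cdot v (r *m v) = cdot (B *m v) (B *m v) by rewrite eB -mulmxA -cdot_adj.
by rewrite e1 e2 e3 mulrC mulrC [X in _ <= X]mulrC; exact: cauchy_schwarz.
Qed.

End Orthogonality.

(** * Bounding the messages when the supports share a unit vector *)

Section Converse.
Variables (R : realType) (a d : nat) (rho : 'I_a -> 'M[R[i]]_d) (beta : 'cV[R[i]]_d).
Local Notation C := R[i].
Hypotheses (st_rho : forall i, is_state (rho i)) (beta1 : cdot beta beta = 1)
  (beta_range : forall i, mxrange (rho i) beta).

Lemma dominating_constant : exists K : C, 0 <= K /\
  forall i, oppsd (fun o o' => K * rho i o o' - beta o 0 * conjc (beta o' 0)).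
Proof.
have [k hk] := choice (fun i => range_dominates (st_rho i).1 (beta_range i)).
have k0 i : 0 <= k i by have [] := hk i.
exists (\sum_i k i); split=> [|i]; first exact: sumr_ge0.
have /psdmx_op p1 := (hk i).2; have /psdmx_op p2 := (st_rho i).1.
have le : 0 <= \sum_j k j - k i.
  by rewrite (bigD1 i) //= addrAC subrr add0r sumr_ge0.
apply: (eq_psd _ (psd_add p1 (psd_scale le p2))) => o o'.
by rewrite !mxE big_ord1 /adjmx !mxE; ring.
Qed.

(* A noiseless bit is at most twice the channel with constant output [1/2]. *)
Lemma round_approximation u :
  exists (st : cq_in (round_chan rho u) ->
               op R (cq_out (round_chan rho u)) (cq_out (round_chan rho u)))
         (D : op R (cq_out (round_chan rho u)) (cq_out (round_chan rho u))) (K : C),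
    [/\ 0 <= K, forall i, density (st i), density D,
        forall i, oppsd (fun o o' => K * cq_st i o o' - st i o o') &
        forall i, oppsd (fun o o' => (if u then 1 else 2) * D o o' - st i o o')].
Proof.
(* For a channel use both [st] and [D] are the constant output $|\beta\rangle\langle\beta|$. For a
   noiseless bit [st] is the bit itself and only [D] is the maximally mixed output. *)
case: u => /=.
  have [K [K0 hK]] := dominating_constant.
  pose D : op R 'I_d 'I_d := fun o o' => beta o 0 * conjc (beta o' 0).
  have dD : density D.
    split; first exact: psd_dyad.
    by rewrite -beta1 cdotE; apply: eq_bigr => i _; rewrite mulrC.
  exists (fun=> D), D, K; split=> // i v.
  rewrite big1 // => o _; rewrite big1 // => o' _.
  by rewrite mul1r subrr mulr0 mul0r.
pose D : op R 'I_2 'I_2 := fun o o' => 2^-1 * (o == o')%:R.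
have id_form (v : 'I_2 -> C) : \sum_o \sum_o' conjc (v o) * (o == o')%:R * v o' =
    \sum_o conjc (v o) * v o.
  apply: eq_bigr => o _; rewrite -[RHS](sum_delta o (fun o' => conjc (v o) * v o')).
  by apply: eq_bigr => o' _; ring.
have bit_form (i : 'I_2) (v : 'I_2 -> C) :
    \sum_o \sum_o' conjc (v o) * ((o == i) && (o' == i))%:R * v o' = conjc (v i) * v i.
  rewrite -[RHS](sum_delta i (fun o => conjc (v o) * v i)); apply: eq_bigr => o _.
  rewrite -[RHS](sum_delta i (fun o' => (i == o)%:R * (conjc (v o) * v o'))).
  by apply: eq_bigr => o' _; rewrite -mulnb natrM !(eq_sym i); ring.
exists (fun (j : 'I_2) o o' => ((o == j) && (o' == j))%:R), D, 1; split=> //.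
- move=> j; split; first by move=> v; rewrite bit_form conjM_ge0.
  rewrite /optr -[RHS](sum_delta j (fun=> 1)); apply: eq_bigr => o _.
  by rewrite andbb mulr1 eq_sym.
- split.
    have h : 0 <= (2^-1 : C) by rewrite invr_ge0.
    apply: psd_scale h _ => v; rewrite id_form.
    by apply: sumr_ge0 => o _; exact: conjM_ge0.
  rewrite /optr /D; under eq_bigr do rewrite eqxx mulr1.
  by rewrite sumr_const card_ord -[_ *+ 2]mulr_natr mulVf // pnatr_eq0.
- move=> j v; rewrite big1 // => o _; rewrite big1 // => o' _.
  by rewrite mul1r subrr mulr0 mul0r.
- move=> j v.
  have -> : \sum_o \sum_o' conjc (v o) * (2 * D o o' - ((o == j) && (o' == j))%:R) * v o' =
     (\sum_o \sum_o' conjc (v o) * (o == o')%:R * v o') -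
     \sum_o \sum_o' conjc (v o) * ((o == j) && (o' == j))%:R * v o'.
    rewrite -sumrB; apply: eq_bigr => o _; rewrite -sumrB; apply: eq_bigr => o' _.
    by rewrite /D; field.
  rewrite id_form bit_form (bigD1 j) //= addrAC subrr add0r.
  by apply: sumr_ge0 => o _; exact: conjM_ge0.
Qed.

Variables (n b M : nat) (c : fcode R a d rho n b M).

Local Notation state m t := (@code_state R a d rho n b M c m t).
Local Notation sched_at := (sched R a d rho n b M c).

(** Three runs with the same isometries are compared: the actual one, [sigma] with channel uses
    replaced by constant outputs, and [Gamma] with every round constant. [K] accumulates the
    constants of the channel uses, while passing from [sigma] to [Gamma] costs a factor 2 per
    noiseless bit only. *)
Lemma code_state_dominates t : (t <= n + b)%N ->
  exists (sigma Gamma : 'I_M -> jstate R 'I_(xd R a d rho n b M c t) 'I_(fd R a d rho n b M c t)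
                                      'I_(yd R a d rho n b M c t)) (K : C),
    [/\ 0 <= K /\ forall m, oppsd (state m t),
        forall m, density (sigma m) /\ density (Gamma m),
        forall m, oppsd (fun p q => K * state m t p q - sigma m p q),
        forall m, oppsd (fun p q =>
          2 ^+ count (predC sched_at) (iota 0 t) * Gamma m p q - sigma m p q) &
        forall m m', bob_marginal (Gamma m) = bob_marginal (Gamma m')].
Proof.
elim: t => [|t IH] tn.
  have dphi : density (fun p q => phi R a d rho n b M c p * conjc (phi R a d rho n b M c q)).
    split; first exact: psd_dyad.
    by rewrite -(phi_unit R a d rho n b M c); apply: eq_bigr => z _; rewrite mulrC.
  exists (fun m => state m 0), (fun m => state m 0), 1; split=> //.
  - by split=> // m; case: dphi.
  - move=> m v; rewrite big1 // => p _; rewrite big1 // => q _.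
    by rewrite mul1r subrr mulr0 mul0r.
  - move=> m v; rewrite big1 // => p _; rewrite big1 // => q _.
    by rewrite expr0 mul1r subrr mulr0 mul0r.
have [sigma [Gamma [K [[K0 ptau] dens dom domG marg]]]] := IH (ltnW tn).
have [st [D [k [k0 dst dD hk hD]]]] := round_approximation (sched_at t).
have iU m := encU_iso R a d rho n b M c m t tn.
have iW := decW_iso R a d rho n b M c t tn.
pose U m := encU R a d rho n b M c m t; pose W := decW R a d rho n b M c t.
have E m : state m t.+1 = one_round (U m) W (cq_st (c := round_chan rho (sched_at t))) (state m t).
  by [].
have pst i : oppsd (st i) by have [] := dst i.
have psig m : oppsd (sigma m) by have [[]] := dens m.
exists (fun m => one_round (U m) W st (sigma m)), (fun m => one_round (U m) W (fun=> D) (Gamma m)),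
  (k * K); split.
- split=> [|m]; first exact: mulr_ge0.
  rewrite E; apply: one_round_psd => // i.
  case: (sched_at t) i => i /=; first exact: (proj1 (psdmx_op _) (st_rho i).1).
  apply: eq_psd (psd_dyad (fun o : 'I_2 => (o == i)%:R)) => o o'.
  by rewrite conjc_delta -natrM mulnb.
- move=> m; have [ds dG] := dens m.
  by split; apply: one_round_density => //; exact: iU.
- by move=> m; rewrite E; exact: one_round_dominated.
- move=> m; have -> : 2 ^+ count (predC sched_at) (iota 0 t.+1) =
      (if sched_at t then 1 else 2) * 2 ^+ count (predC sched_at) (iota 0 t) :> C.
    rewrite -[in LHS](addn1 t) iotaD count_cat add0n /= addn0.
    by case: (sched_at t) => /=; rewrite ?addn0 ?addn1 ?mul1r ?exprS.
  apply: one_round_dominated => //.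
  by case: (sched_at t).
- by move=> m m'; rewrite (one_round_marginal _ _ _ (iU m)) (one_round_marginal _ _ _ (iU m')) (marg m m').
Qed.

Lemma messages_le : zero_error c -> (M <= 2 ^ b)%N.
Proof.
move=> ze.
have [sigma [Gamma [K [[K0 ptau] dens dom domG marg]]]] := code_state_dominates (leqnn _).
case: (posnP M) => [->//|M0]; pose m0 : 'I_M := Ordinal M0.
have cnt : count (predC sched_at) (iota 0 (n + b)) = b.
  apply: (@addnI n); rewrite -{1}(sched_count R a d rho n b M c) count_predC.
  by rewrite size_iota.
rewrite cnt in domG.
pose mx (A : op R 'I_(yd R a d rho n b M c (n + b)) 'I_(yd R a d rho n b M c (n + b))) :=
  (\matrix_(i, j) A i j : 'M[C]_(yd R a d rho n b M c (n + b))).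
have psd_mx A : oppsd A -> psdmx (mx A).
  by move=> pA; apply/psdmx_op; apply: eq_psd pA => i j; rewrite mxE.
have tr_mx A : \tr (mx A) = optr A by apply: eq_bigr => i _; rewrite mxE.
have lin (k : C) (x y : jstate R 'I_(xd R a d rho n b M c (n + b)) 'I_(fd R a d rho n b M c (n + b))
    'I_(yd R a d rho n b M c (n + b))) :
    k *: mx (bob_marginal x) - mx (bob_marginal y) =
    mx (bob_marginal (fun p q => k * x p q - y p q)).
  by apply/matrixP => i j; rewrite !mxE /bob_marginal mulr_sumr -sumrB.
rewrite -(ler_nat C) natrX.
apply: (@orth_states_bound _ _ _ (fun m => mx (bob_marginal (state m (n + b))))
  (fun m => mx (bob_marginal (sigma m))) (mx (bob_marginal (Gamma m0))) K).
- by rewrite exprn_ge0.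
- by move=> m; apply: psd_mx; exact: bob_marginal_psd.
- by move=> m; apply: psd_mx; apply: bob_marginal_psd; have [[]] := dens m.
- by move=> m; rewrite tr_mx bob_marginal_trace; have [[]] := dens m.
- by apply: psd_mx; apply: bob_marginal_psd; have [_ []] := dens m0.
- by rewrite tr_mx bob_marginal_trace; have [_ []] := dens m0.
- by move=> m; rewrite lin; apply: psd_mx; exact: bob_marginal_psd.
- by move=> m; rewrite (marg m0 m) lin; apply: psd_mx; exact: bob_marginal_psd.
move=> m m' mm'; apply/matrixP => i j; rewrite !mxE.
(* Columns lie in the range, so the zero-error condition applied to pairs of columns makes the
   matrix product vanish. *)
have col_range m1 k : oprange (bob_final (c := c) m1) (fun y => bob_final m1 y k).
  exists (fun l => (k == l)%:R); apply: funext => y.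
  rewrite -[LHS](sum_delta k (fun l => bob_final m1 y l)).
  by apply: eq_bigr => l _; rewrite mulrC.
rewrite -[RHS](ze m m' mm' _ _ (col_range m i) (col_range m' j)).
by apply: eq_bigr => y _; rewrite !mxE.
Qed.

End Converse.

Lemma trivial_C0EF_act (R : realType) (a d : nat) (rho : 'I_a -> 'M[R[i]]_d) (beta : 'cV[R[i]]_d) :
  (forall i, is_state (rho i)) -> cdot beta beta = 1 -> (forall i, mxrange (rho i) beta) ->
  (C0EF_act rho <= 0)%E.
Proof.
move=> st_rho beta1 beta_range; apply: C0EF_act_le0 => b n M [c].
exact: messages_le st_rho beta1 beta_range _ _ _ _.
Qed.

(** * The equivalence *)

Section Conditions.
Local Open Scope classical_set_scope.
Variables (R : realType) (a d : nat) (rho P : 'I_a -> 'M[R[i]]_d).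
Local Notation C := R[i].
Local Notation "c %:C" := (real_complex R c).
Hypotheses (a_gt0 : (0 < a)%N) (st_rho : forall i, is_state (rho i))
  (sp : forall i, is_supp_proj (P i) (rho i)).

Let PP i : P i *m P i = P i. Proof. by have [] := sp i. Qed.
Let Ph i : adjmx (P i) = P i. Proof. by have [_ []] := sp i. Qed.

Lemma mxrange_scale m n (A : 'M[C]_(m, n)) c v : mxrange A v -> mxrange A (c *: v).
Proof. by move=> [w ->]; exists (c *: w); rewrite scalemxAr. Qed.

Lemma mxrange_sum m n (A : 'M[C]_(m, n)) (I : finType) (F : I -> 'cV[C]_m) :
  (forall i, mxrange A (F i)) -> mxrange A (\sum_i F i).
Proof.
move=> /choice[w hw]; exists (\sum_i w i).
by rewrite mulmx_sumr; apply: eq_bigr => i _.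
Qed.

Lemma mul_bra (v : 'cV[C]_d) (i j : 'I_a) :
  v *m bra R i *m delta_mx j 0 = (i == j)%:R *: v.
Proof.
rewrite -mulmxA /bra mul_delta_mx_cond; have [_|_] := eqVneq i j.
  rewrite mulr1n scale1r; apply/colP => k; rewrite mxE big_ord1 mxE !eqxx.
  by rewrite mulr1.
by rewrite mulr0n mulmx0 scale0r.
Qed.

Lemma trivialK_common : trivialK rho <->
  exists beta : 'cV[C]_d, cdot beta beta = 1 /\ forall i, mxrange (rho i) beta.
Proof.
split=> [[beta [/vnorm1P b1 inK]]|[beta [b1 rg]]].
  exists beta; split=> // i.
  (* For $x=e_i$ the [i]-th column of the decomposition of $|\beta\rangle\langle i|$ expresses
     [beta] through vectors of $K_i$ alone. *)
  have [k [c [idx [psi [hpsi e]]]]] := inK (delta_mx i 0).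
  have adj_delta : adjmx (delta_mx i 0 : 'cV[C]_a) = bra R i.
    by apply/matrixP => x y; rewrite /adjmx /bra !mxE conjc_nat andbC.
  have -> : beta = \sum_(j < k) c j *: ((idx j == i)%:R *: psi j).
    have /= := congr1 (fun N : 'M[C]_(d, a) => N *m (delta_mx i 0 : 'cV[C]_a)) e.
    rewrite adj_delta mul_bra eqxx scale1r => ->.
    by rewrite mulmx_suml; apply: eq_bigr => j _; rewrite -scalemxAl mul_bra.
  apply: mxrange_sum => j; apply: mxrange_scale.
  have [<-|_] := eqVneq (idx j) i; first exact: mxrange_scale.
  by rewrite scale0r; exists 0; rewrite mulmx0.
exists beta; split; first exact/vnorm1P.
move=> x; exists a, (fun j => conjc (x j 0)), id, (fun=> beta); split=> //.
apply/matrixP => p q; rewrite summxE mxE big_ord1 /adjmx !mxE.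
rewrite -[LHS](sum_delta q (fun j => beta p 0 * conjc (x j 0))).
apply: eq_bigr => j _; rewrite !mxE big_ord1 /bra mxE eqxx /=; ring.
Qed.

Lemma capacity_nontrivial : (0 < C0EF_act rho)%E -> ~ trivialK rho.
Proof.
move=> pos /trivialK_common[beta [b1 rg]].
by have := trivial_C0EF_act st_rho b1 rg; rewrite leNgt pos.
Qed.

Lemma nontrivial_cap : ~ trivialK rho ->
  forall v : 'cV[C]_d, (forall i, mxrange (rho i) v) -> v = 0.
Proof.
move=> nt v rg; apply/eqP; apply: contrapT => /negP v0; apply: nt; apply/trivialK_common.
have [c c1] := exists_unit_scale v0.
by exists (c *: v); split=> // i; exact: mxrange_scale.
Qed.

Lemma cap_fix : (forall v : 'cV[C]_d, (forall i, mxrange (rho i) v) -> v = 0) ->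
  forall v : 'cV[C]_d, (forall i, P i *m v = v) -> v = 0.
Proof. by move=> cap v fix_v; apply: cap => i; apply/(mxrange_supp v (sp i)). Qed.

Lemma unit_fix (v : 'cV[C]_d) : v != 0 -> (forall i, P i *m v = v) ->
  exists u : 'cV[C]_d, cdot u u = 1 /\ forall i, P i *m u = u.
Proof.
move=> v0 fix_v; have [c c1] := exists_unit_scale v0; exists (c *: v); split=> // i.
by rewrite -scalemxAr fix_v.
Qed.

Lemma cap_opnorm : (forall v : 'cV[C]_d, (forall i, mxrange (rho i) v) -> v = 0) ->
  opnorm (\sum_(i < a) P i) < a%:R.
Proof.
move=> /cap_fix cap; have [c [c0 ca _ gap]] := proj_sum_gap a_gt0 PP Ph cap.
apply: le_lt_trans ca; rewrite /opnorm.
set S := (X in sup X).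
(* In dimension zero there are no unit vectors, and the supremum of the empty set is 0 by
   convention. *)
have [S0|S0] := pselect (S !=set0); last first.
  by rewrite sup_out ?ltW // => -[].
apply: ge_sup => // _ [v /vnorm1P v1 <-].
rewrite vnorm_le ?(ltW c0) //; apply: le_trans (gap v) _.
by rewrite v1 mulr1.
Qed.

(** The supremum is meaningful only for a bounded set; boundedness comes from [norm_le_exists]. *)
Lemma opnorm_ub n (A : 'M[C]_n) (v : 'cV[C]_n) : cdot v v = 1 -> vnorm (A *m v) <= opnorm A.
Proof.
move=> v1; apply: ub_le_sup; last by exists v => //; exact/vnorm1P.
have [k hk] := norm_le_exists A.
have c0 : 0 < 2 + k%:R :> R by rewrite -natrD ltr0n.
exists (2 + k%:R) => _ [u /vnorm1P u1 <-]; rewrite vnorm_le ?(ltW c0) //.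
have := norm_le_sqr u c0 hk; rewrite u1 mulr1.
set c := 2 + k%:R in c0 *; set w := cdot _ _ => h.
have cc : 0 < c%:C by rewrite ltc0R.
by rewrite rmorphXn expr2 /= -ler_pdivrMl //; rewrite fmorphV in h.
Qed.

Lemma opnorm_cap : opnorm (\sum_(i < a) P i) < a%:R ->
  forall v : 'cV[C]_d, (forall i, P i *m v = v) -> v = 0.
Proof.
move=> small v fix_v; apply/eqP; apply: contrapT => /negP v0.
have [u [u1 fix_u]] := unit_fix v0 fix_v.
have := le_lt_trans (opnorm_ub (\sum_(i < a) P i) u1) small.
have -> : (\sum_(i < a) P i) *m u = a%:R *: u.
  by rewrite mulmx_suml (eq_bigr _ (fun i _ => fix_u i)) sumr_const card_ord scaler_nat.
rewrite ltNge => /negP; apply.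
rewrite /vnorm cdotZl cdotZr u1 mulr1 conjc_nat -natrM.
have -> : complex.Re ((a * a)%N%:R : C) = (a%:R : R) ^+ 2.
  by rewrite -(rmorph_nat (real_complex R)) /= natrM expr2.
by rewrite sqrtr_sqr ger0_norm.
Qed.

Lemma feasible_form (s : 'I_a -> R) (v : 'cV[C]_d) :
  cdot v ((\sum_(i < a) (s i)%:C *: P i) *m v) = \sum_i (s i)%:C * cdot (P i *m v) (P i *m v).
Proof.
rewrite mulmx_suml cdot_sumr; apply: eq_bigr => i _.
by rewrite -scalemxAl cdotZr cdot_proj.
Qed.

Lemma cap_AK : (forall v : 'cV[C]_d, (forall i, P i *m v = v) -> v = 0) -> 1 < AK P.
Proof.
move=> cap; have [c [c0 ca gap _]] := proj_sum_gap a_gt0 PP Ph cap.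
apply: (@lt_le_trans _ _ (a%:R / c)); first by rewrite ltr_pdivlMr // mul1r.
apply: ub_le_sup; last first.
  (* The uniform weights $1/c$ are feasible since $\sum_iP_i\le c$, and they sum to $a/c>1$. *)
  exists (fun=> c^-1); last by rewrite sumr_const card_ord mulr_natl.
  split=> [_|v]; first by rewrite invr_ge0 ltW.
  rewrite mulmxBl mul1mx cdotBr -scaler_sumr -scalemxAl cdotZr subr_ge0 fmorphV.
  by rewrite ler_pdivrMl ?gap // ltc0R.
(* Boundedness of the feasible sums: each $K_i$ contains a unit vector because $\rho_i$ has trace
   one, and testing there gives $s_i\le1$. *)
exists a%:R => _ [s [s0 feas] <-].
have -> : a%:R = \sum_(i < a) (1 : R) by rewrite sumr_const card_ord.
apply: ler_sum => i _.
have [j rj] : exists j, col j (rho i) != 0.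
  apply: contrapT => no; have [_] := st_rho i.
  have -> : rho i = 0.
    apply/matrixP => x y; have [/colP/(_ x)|cy] := eqVneq (col y (rho i)) 0.
      by rewrite !mxE.
    by case: no; exists y.
  by rewrite mxtrace0 => /esym/eqP; rewrite oner_eq0.
have fix_col : P i *m col j (rho i) = col j (rho i).
  by apply/(mxrange_supp _ (sp i)); exists (delta_mx j 0); rewrite colE.
have [k k1] := exists_unit_scale rj.
set v := k *: _ in k1; have fix_v : P i *m v = v by rewrite /v -scalemxAr fix_col.
have := feas v; rewrite mulmxBl mul1mx cdotBr feasible_form k1 subr_ge0 (bigD1 i) //= fix_v k1 mulr1.
move=> h; rewrite -lecR rmorph1; apply: le_trans h.
rewrite lerDl; apply: sumr_ge0 => l _; rewrite mulr_ge0 ?cdot_ge0 // ler0c.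
exact: s0.
Qed.

(** At a unit vector fixed by all $P_i$ the constraint reads $\sum_is_i\le1$. *)
Lemma AK_cap : 1 < AK P -> forall v : 'cV[C]_d, (forall i, P i *m v = v) -> v = 0.
Proof.
move=> big v fix_v; apply/eqP; apply: contrapT => /negP v0.
have [u [u1 fix_u]] := unit_fix v0 fix_v.
move: big; rewrite ltNge => /negP; apply; apply: ge_sup.
  exists (\sum_(i < a) 0); exists (fun=> 0) => //; split=> // w.
  rewrite big1 => [|i _]; last by rewrite rmorph0 scale0r.
  by rewrite subr0 mul1mx cdot_ge0.
move=> _ [s [s0 feas] <-].
have := feas u; rewrite mulmxBl mul1mx cdotBr feasible_form u1 subr_ge0.
rewrite (eq_bigr (fun i => (s i)%:C)) => [|i _]; last by rewrite fix_u u1 mulr1.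
by rewrite -rmorph_sum -(rmorph1 (real_complex R)) lecR.
Qed.

Lemma excludable_capacity n (t : n.-tuple 'I_a) : type_excludable rho t -> (0 < C0EF_act rho)%E.
Proof.
move=> excl.
have [b [K codes]] := exponentially_many_messages a_gt0 (fun i => (st_rho i).1) excl.
exact: C0EF_act_gt0 codes.
Qed.

End Conditions.

Unset Implicit Arguments.
Set Strict Implicit.
Set Printing Implicit Defensive.

Theorem theorem6 (R : realType) (a d : nat) (rho P : 'I_a -> 'M[R[i]]_d) :
  (0 < a)%N ->
  (forall i, is_state (rho i)) ->
  (forall i, is_supp_proj (P i) (rho i)) ->
  [<-> (0 < C0EF_act rho)%E;
       ~ trivialK rho;
       (forall v : 'cV[R[i]]_d, (forall i, mxrange (rho i) v) -> v = 0);
       opnorm (\sum_(i < a) P i) < a%:R;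
       1 < AK P;
       exists (n : nat) (t : n.-tuple 'I_a), type_excludable rho t].
Proof.
(* One cycle of implications in the order of the list; the steps from the norm to the exclusion
   condition pass through the absence of nonzero vectors fixed by all $P_i$. *)
move=> a_gt0 st_rho sp; tfae.
- exact: capacity_nontrivial.
- exact: nontrivial_cap.
- exact: cap_opnorm.
- by move=> h; apply: (@cap_AK R a d rho P) => //; exact: (@opnorm_cap R a d P h).
- by move=> h; apply: (@trivial_cap_excludable R a d rho P) => //; exact: (@AK_cap R a d rho P).
- by move=> [n [t]]; exact: excludable_capacity.
Qed.
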